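(* Let $\lambda$ be a Cherednik diagram of degree $n$. The element $E_\lambda\in\mathcal H_n$ can be calculated as follows: (1) arrange the elementary factors $\varphi_\beta=T_{j-i}+\langle x_j/x_i\rangle$, for $\beta=(i,j)\in\mathcal P$, of the product $\varphi_0=\prod_{\beta\in\mathcal P}\varphi_\beta$ according to the special order on $\mathcal P$; (2) for every $\xi=(i,j)\in\mathcal R$, with $k=j-i-1$, replace the two adjacent factors corresponding to $\xi$ by a three-term factor: if $e(\xi)=-$, replace $\varphi_{\xi^-}\varphi_{\xi}$ by $T_kT_{k+1}-q\,T_{k+1}-q$; if $e(\xi)=+$, replace $\varphi_{\xi}\varphi_{\xi^+}$ by $T_{k+1}T_k-q\,T_{k+1}-q$; (3) replace each factor indexed by a singular pair $\beta\notin\mathcal R$ by the scalar $1-q$; (4) evaluate the factors corresponding to the remaining non-singular pairs at the point $(x_1,\ldots,x_n)=(q^{c_1},\ldots,q^{c_n})$. That is, the resulting ordered product equals $E_\lambda$.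
   Context: **Hecke algebra.** $q$ is a formal parameter. $\mathcal H_n$ is the associative $\mathbb C(q)$-algebra with generators $T_1,\ldots,T_{n-1}$ and relations $T_kT_{k+1}T_k=T_{k+1}T_kT_{k+1}$ for $1\le k\le n-2$; $T_kT_l=T_lT_k$ for $|k-l|>1$; $(T_k-q)(T_k+1)=0$. $s_k=(k,k+1)\in\mathcal S_n$ and $w_0$ is the longest element of $\mathcal S_n$. **Cherednik diagrams.** A diagram $\lambda=(\lambda_1,\ldots,\lambda_r)$ with rows $\lambda_i=[a_i,b_i]$ (integers $a_i\le b_i$) is the set of boxes $\{(i,j)\in\mathbb Z^2\mid 1\le i\le r,\ a_i\le j\le b_i\}$; its degree is $n=\sum_i(b_i-a_i+1)$. It is a Cherednik diagram if for each $i=1,\ldots,r-1$ either $b_{i+1}\le b_i$, or $b_{i+1}=b_i+1$ and $a_{i+1}\le a_i+1$. The row filling $\Lambda$ is obtained by filling the boxes with $1,\ldots,n$, row by row from left to right and then from top (row $1$) to bottom (row $r$). The content of the box $(i,j)$ is $j-i$, and $c_k$ is the content of the box filled with $k$ in $\Lambda$. Rows $\lambda_i,\lambda_j$ are parallel if $a_i-i=a_j-j$ and $b_i-i=b_j-j$. **The element $E_\lambda$.** Put $\langle x\rangle=(1-q)/(1-x)$ and $\varphi_k(x_1,\ldots,x_n)=T_k+\langle x_{k+1}/x_k\rangle$. For $w\in\mathcal S_n$ and an $\mathcal H_n$-valued rational function $\psi$ put ${}^w\psi(x_1,\ldots,x_n)=\psi(x_{w(1)},\ldots,x_{w(n)})$.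 For a reduced decomposition $w_0=s_{k_1}\cdots s_{k_m}$ put $\varphi_0=\varphi_{k_1}({}^{s_{k_1}}\varphi_{k_2})\cdots({}^{s_{k_1}\cdots s_{k_{m-1}}}\varphi_{k_m})$, which is independent of the choice of the decomposition. $\delta_\lambda(x_1,\ldots,x_n)$ is the product of $1-x_l/x_k$ over all $k<l$ occurring in $\Lambda$ in the leftmost boxes of two parallel rows of $\lambda$ ($\delta_\lambda=1$ if there are none). $\mathcal F_\lambda\subset\mathbb C(q)^{\times n}$ is the affine subspace of points with $x_kq^{c_l}=q^{c_k}x_l$ whenever $k,l$ are in the same row of $\Lambda$. The restriction of $\delta_\lambda\varphi_0$ to $\mathcal F_\lambda$ is regular at $(q^{c_1},\ldots,q^{c_n})$, and $E_\lambda\in\mathcal H_n$ is its value there. **Special order.** $\mathcal P=\{(i,j)\mid1\le i<j\le n\}$. On $\mathcal P$: $(i,j)<_1(k,l)$ iff $i<k$, or $i=k$ and $j<l$; $(i,j)<_2(k,l)$ iff $j<l$, or $j=l$ and $i<k$. For $1\le k\le l\le r$ let $\mathcal P_{kl}$ be the set of $(i,j)\in\mathcal P$ with $i,j$ in rows $k,l$ of $\Lambda$ respectively. The special order on $\mathcal P$ restricts on $\mathcal P_{kl}$ to $<_1$ if $b_k-k=b_l-l$ and to $<_2$ otherwise, and the blocks are ordered by $\mathcal P_{11}<\mathcal P_{12}<\mathcal P_{22}<\ldots<\mathcal P_{1r}<\mathcal P_{2r}<\ldots<\mathcal P_{rr}$. With respect to this order, $\varphi_0$ is the ordered product over $(i,j)\in\mathcal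 P$ of the factors $T_{j-i}+\langle x_j/x_i\rangle$. **Singular pairs.** A pair $(i,j)\in\mathcal P$ is singular if $c_i=c_j$. $\mathcal R$ is the set of all singular pairs except the pairs $(i,j)$ where $i$ and $j$ are the first numbers in two parallel rows of $\Lambda$. For a singular pair $\xi=(i,j)$ put $\xi^+=(i+1,j)$ if $i,i+1$ are in the same row of $\Lambda$, and $\xi^-=(i,j-1)$ if $j-1,j$ are in the same row of $\Lambda$. For $\xi\in\mathcal P_{kl}$ put $e(\xi)=-$ if $b_k-k=b_l-l$ and $e(\xi)=+$ otherwise. For $\xi\in\mathcal R$ the pair $\xi^{e(\xi)}$ is defined and adjacent to $\xi$ in the special order ($\xi^-$ immediately precedes $\xi$, respectively $\xi^+$ immediately follows $\xi$), and the pairs $\xi^{e(\xi)}$, $\xi\in\mathcal R$, are distinct. *)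

(* Defs.v *)
From HB Require Import structures.
From mathcomp Require Import all_boot all_order all_algebra perm.
From mathcomp Require Import generic_quotient ring_quotient.
From mathcomp Require Import boolp classical_sets reals complex.
From mathcomp Require mpoly monalg.

Set Implicit Arguments.
Unset Strict Implicit.
Unset Printing Implicit Defensive.

Import GRing.Theory.
Local Open Scope ring_scope.
Local Open Scope quotient_scope.

Section QuotientAlgebra.
Variables (K : fieldType) (A : algType K) (rel : A -> Prop).

(* The two-sided ideal generated by rel: finite sums of terms a r b with rel r. *)
Inductive in_ideal : A -> Prop :=
| InIdeal0 : in_ideal 0
| InIdealD x a r b : in_ideal x -> rel r -> in_ideal (x + a * r * b).

Definition gen_ideal : {pred A} := fun x => `[< in_ideal x >].

Lemma gen_idealP x : reflect (in_ideal x) (x \in gen_ideal).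
Proof. exact: asboolP. Qed.

Lemma gen_idealD x y :
  x \in gen_ideal -> y \in gen_ideal -> x + y \in gen_ideal.
Proof.
move=> /gen_idealP Ix /gen_idealP Iy; apply/gen_idealP.
elim: Iy => [|z a r b _ IH Rr]; first by rewrite addr0.
by rewrite addrA; apply: InIdealD.
Qed.

Lemma gen_idealMl c x : x \in gen_ideal -> c * x \in gen_ideal.
Proof.
move=> /gen_idealP Ix; apply/gen_idealP.
elim: Ix => [|z a r b _ IH Rr]; first by rewrite mulr0; apply: InIdeal0.
by rewrite mulrDr !mulrA; apply: InIdealD.
Qed.

Lemma gen_idealMr d x : x \in gen_ideal -> x * d \in gen_ideal.
Proof.
move=> /gen_idealP Ix; apply/gen_idealP.
elim: Ix => [|z a r b _ IH Rr]; first by rewrite mul0r; apply: InIdeal0.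
by rewrite mulrDl -mulrA; apply: InIdealD.
Qed.

Lemma rel_gen_ideal r : rel r -> r \in gen_ideal.
Proof.
move=> Rr; apply/gen_idealP.
rewrite -[r]mulr1 -[r]mul1r -[X in in_ideal X]add0r.
by apply: InIdealD => //; apply: InIdeal0.
Qed.

Lemma gen_ideal_zmod : zmod_closed gen_ideal.
Proof.
split=> [|x y Ix Iy]; first by apply/gen_idealP; apply: InIdeal0.
by apply: gen_idealD => //; rewrite -mulN1r; apply: gen_idealMl.
Qed.

HB.instance Definition _ := GRing.isZmodClosed.Build A gen_ideal gen_ideal_zmod.

Hypothesis proper : 1 \notin gen_ideal.

(* The properness proof is a phantom argument of the type, which lets the ring
   structure (with 1 != 0) be declared once for all proper ideals. *)
Definition quot_alg of 1 \notin gen_ideal : Type := Quotient.quot gen_ideal.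
Local Notation Q := (quot_alg proper).

HB.instance Definition _ := GRing.Zmodule.on Q.

Definition quot_pi (x : A) : Q := \pi_(Quotient.quot gen_ideal) x.
Local Notation pi := quot_pi.

Lemma quot_piP (x y : A) : reflect (pi x = pi y) (x - y \in gen_ideal).
Proof. by rewrite Quotient.idealrBE; apply: eqP. Qed.

Lemma quot_pi0 : pi 0 = 0.
Proof. by rewrite /quot_pi pi_zeror. Qed.

Lemma quot_piD x y : pi (x + y) = pi x + pi y.
Proof. by rewrite /quot_pi pi_addr. Qed.

Lemma quot_piB x y : pi (x - y) = pi x - pi y.
Proof. by rewrite quot_piD; congr (_ + _); rewrite /quot_pi pi_oppr. Qed.

Lemma quot_pi_surj (P : Q -> Prop) : (forall x, P (pi x)) -> forall u, P u.
Proof. by move=> PP u; have := PP (repr u); rewrite /quot_pi reprK. Qed.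

Let qone : Q := pi 1.
Let qmul (u v : Q) : Q := pi (repr u * repr v).
Let qscale (k : K) (u : Q) : Q := pi (k *: repr u).

Let repr_pi x : x - repr (pi x) \in gen_ideal.
Proof. by apply/quot_piP; rewrite /quot_pi reprK. Qed.

Let piM x y : qmul (pi x) (pi y) = pi (x * y).
Proof.
apply/esym/quot_piP; set x' := repr _; set y' := repr _.
have -> : x * y - x' * y' = (x - x') * y + x' * (y - y').
  by rewrite mulrBl mulrBr addrA subrK.
by apply: gen_idealD; [apply: gen_idealMr | apply: gen_idealMl]; apply: repr_pi.
Qed.

Let piZ k x : qscale k (pi x) = pi (k *: x).
Proof.
by apply/esym/quot_piP; rewrite -scalerBr -mulr_algl; apply/gen_idealMl/repr_pi.
Qed.

Let qmulA : associative qmul.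
Proof.
elim/quot_pi_surj=> x; elim/quot_pi_surj=> y; elim/quot_pi_surj=> z.
by rewrite !piM mulrA.
Qed.

Let qmul1l : left_id qone qmul.
Proof. by elim/quot_pi_surj=> x; rewrite piM mul1r. Qed.

Let qmul1r : right_id qone qmul.
Proof. by elim/quot_pi_surj=> x; rewrite piM mulr1. Qed.

Let qmulDl : left_distributive qmul +%R.
Proof.
elim/quot_pi_surj=> x; elim/quot_pi_surj=> y; elim/quot_pi_surj=> z.
by rewrite -quot_piD !piM mulrDl quot_piD.
Qed.

Let qmulDr : right_distributive qmul +%R.
Proof.
elim/quot_pi_surj=> x; elim/quot_pi_surj=> y; elim/quot_pi_surj=> z.
by rewrite -quot_piD !piM mulrDr quot_piD.
Qed.

Let qone_neq0 : qone != 0.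
Proof.
by rewrite -quot_pi0; apply/eqP => /quot_piP; rewrite subr0 (negPf proper).
Qed.

HB.instance Definition _ := GRing.Zmodule_isNzRing.Build Q
  qmulA qmul1l qmul1r qmulDl qmulDr qone_neq0.

Let qscaleA a b u : qscale a (qscale b u) = qscale (a * b) u.
Proof. by elim/quot_pi_surj: u => x; rewrite !piZ scalerA. Qed.

Let qscale1 : left_id 1 qscale.
Proof. by elim/quot_pi_surj=> x; rewrite piZ scale1r. Qed.

Let qscaleDr : right_distributive qscale +%R.
Proof.
move=> k; elim/quot_pi_surj=> x; elim/quot_pi_surj=> y.
by rewrite -quot_piD !piZ scalerDr quot_piD.
Qed.

Let qscaleDl u : {morph qscale^~ u : a b / a + b}.
Proof.
by move=> a b; elim/quot_pi_surj: u => x; rewrite !piZ scalerDl quot_piD.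
Qed.

HB.instance Definition _ := GRing.Zmodule_isLmodule.Build K Q
  qscaleA qscale1 qscaleDr qscaleDl.

Lemma quot_piM x y : pi (x * y) = pi x * pi y.
Proof. exact/esym/piM. Qed.

Lemma quot_piZ k x : pi (k *: x) = k *: pi x.
Proof. exact/esym/piZ. Qed.

Let qscaleAl (k : K) (u v : Q) : k *: (u * v) = (k *: u) * v.
Proof.
elim/quot_pi_surj: u => x; elim/quot_pi_surj: v => y.
by rewrite -quot_piM -!quot_piZ -quot_piM scalerAl.
Qed.

HB.instance Definition _ := GRing.Lmodule_isLalgebra.Build K Q qscaleAl.

Let qscaleAr (k : K) (u v : Q) : k *: (u * v) = u * (k *: v).
Proof.
elim/quot_pi_surj: u => x; elim/quot_pi_surj: v => y.
by rewrite -quot_piM -!quot_piZ -quot_piM scalerAr.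
Qed.

HB.instance Definition _ := GRing.Lalgebra_isAlgebra.Build K Q qscaleAr.

Lemma quot_pi_rel r : rel r -> pi r = 0.
Proof.
by move=> Rr; rewrite -quot_pi0; apply/quot_piP; rewrite subr0; apply: rel_gen_ideal.
Qed.

End QuotientAlgebra.

Section FreeAlgebra.
Import monalg.
Variables (K : fieldType) (I : choiceType).

Definition free_alg : Type := {malg K[{fmonom I}]}.

HB.instance Definition _ := GRing.Lalgebra.copy free_alg {malg K[{fmonom I}]}.

Let free_scalerAr (k : K) (x y : free_alg) : k *: (x * y) = x * (k *: y).
Proof.
have comm u : k%:MP * u = u * k%:MP :> {malg K[{fmonom I}]}.
  rewrite !malgM_def fgmulUg fgmulgU; apply: eq_bigr => m _.
  by rewrite mul1m mulm1 mulrC.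
have scale u : k *: u = k%:MP * u :> {malg K[{fmonom I}]} by rewrite mul_malgC.
rewrite [LHS]scale [X in _ = x * X]scale.
by rewrite [LHS]mulrA [X in X * _]comm -[LHS]mulrA.
Qed.

HB.instance Definition _ :=
  GRing.Lalgebra_isAlgebra.Build K free_alg free_scalerAr.

Definition free_gen (i : I) : free_alg := << fmu i >>.

Section Evaluation.
Variable c : K.

Let char (m : {fmonom I}) : K := c ^+ size (fmonom_val m).

Let char_morph : mmorphism char.
Proof.
split=> [x y|]; rewrite /char /mmul /mone /=.
  by rewrite fmmulE /= size_cat exprD.
by rewrite fmoneE.
Qed.

HB.instance Definition _ := isMultiplicative.Build _ _ char char_morph.

Definition free_eval (x : free_alg) : K := mmap idfun char x.

Let free_eval_zmod : zmod_morphism free_eval.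
Proof. by move=> x y; apply: mmapB. Qed.

Let free_eval_monoid : monoid_morphism free_eval.
Proof.
split; first exact: mmap1.
exact: (mmap_is_multiplicative (f := idfun) (h := char)).1.
Qed.

HB.instance Definition _ :=
  GRing.isZmodMorphism.Build free_alg K free_eval free_eval_zmod.
HB.instance Definition _ :=
  GRing.isMonoidMorphism.Build free_alg K free_eval free_eval_monoid.

Lemma free_evalZ a x : free_eval (a *: x) = a * free_eval x.
Proof. exact: mmapZ. Qed.

Lemma free_eval_gen i : free_eval (free_gen i) = c.
Proof. by rewrite /free_eval mmapU mul1r /char fmuE expr1. Qed.

End Evaluation.
End FreeAlgebra.

Section HeckeRelators.
Variables (K : fieldType) (q : K) (n : nat) (A : algType K) (t : 'I_n.-1 -> A).

(* The ordinal k : 'I_n.-1 stands for the index k+1 of the generator T_(k+1). *)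
Inductive hecke_relator : A -> Prop :=
| HeckeBraid (k l : 'I_n.-1) : l = k.+1 :> nat ->
    hecke_relator (t k * t l * t k - t l * t k * t l)
| HeckeComm (k l : 'I_n.-1) : (k.+1 < l)%N || (l.+1 < k)%N ->
    hecke_relator (t k * t l - t l * t k)
| HeckeQuad (k : 'I_n.-1) :
    hecke_relator ((t k - q%:A) * (t k + 1)).

(* A character sending every generator to q kills the relators, so that the
   quotient is nonzero, as required by nzRingType. *)
Lemma hecke_relator_proper (ev : {rmorphism A -> K}) :
  (forall a x, ev (a *: x) = a * ev x) -> (forall k, ev (t k) = q) ->
  1 \notin gen_ideal hecke_relator.
Proof.
move=> evZ evt; apply/gen_idealP => I1.
suff H x : in_ideal hecke_relator x -> ev x = 0.
  by have /eqP := H _ I1; rewrite rmorph1 oner_eq0.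
elim=> [|z a r b _ IH Rr]; first exact: rmorph0.
rewrite rmorphD IH add0r !rmorphM; suff -> : ev r = 0 by rewrite mulr0 mul0r.
case: Rr => [k l _|k l _|k].
- by rewrite rmorphB !rmorphM /= !evt subrr.
- by rewrite rmorphB !rmorphM /= !evt subrr.
- by rewrite rmorphM rmorphB /= evt evZ rmorph1 mulr1 subrr mul0r.
Qed.

Hypothesis proper : 1 \notin gen_ideal hecke_relator.
Local Notation T := (fun k => quot_pi proper (t k)).

Lemma quot_braid (k l : 'I_n.-1) : l = k.+1 :> nat ->
  T k * T l * T k = T l * T k * T l.
Proof.
move=> /HeckeBraid /(quot_pi_rel proper) /eqP.
by rewrite quot_piB !quot_piM subr_eq0 => /eqP.
Qed.

Lemma quot_comm (k l : 'I_n.-1) : (k.+1 < l)%N || (l.+1 < k)%N ->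
  T k * T l = T l * T k.
Proof.
move=> /HeckeComm /(quot_pi_rel proper) /eqP.
by rewrite quot_piB !quot_piM subr_eq0 => /eqP.
Qed.

Lemma quot_quad (k : 'I_n.-1) : (T k - q%:A) * (T k + 1) = 0.
Proof.
have /(quot_pi_rel proper) := HeckeQuad k.
by rewrite quot_piM quot_piB quot_piD quot_piZ.
Qed.

End HeckeRelators.

Section HeckeDef.
Variables (K : fieldType) (q : K) (n : nat).
Local Notation t := (@free_gen K 'I_n.-1).

Lemma hecke_ideal_proper : 1 \notin gen_ideal (hecke_relator q t).
Proof.
exact: (hecke_relator_proper (ev := free_eval q)
          (free_evalZ q) (free_eval_gen q)).
Qed.

Definition Hecke : Type := quot_alg hecke_ideal_proper.

HB.instance Definition _ := GRing.Algebra.on Hecke.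

Definition hecke_gen (k : 'I_n.-1) : Hecke := quot_pi hecke_ideal_proper (t k).

Lemma hecke_braid (k l : 'I_n.-1) : l = k.+1 :> nat ->
  hecke_gen k * hecke_gen l * hecke_gen k =
  hecke_gen l * hecke_gen k * hecke_gen l.
Proof. exact: quot_braid. Qed.

Lemma hecke_comm (k l : 'I_n.-1) : (k.+1 < l)%N || (l.+1 < k)%N ->
  hecke_gen k * hecke_gen l = hecke_gen l * hecke_gen k.
Proof. exact: quot_comm. Qed.

Lemma hecke_quad (k : 'I_n.-1) :
  (hecke_gen k - q%:A) * (hecke_gen k + 1) = 0.
Proof. exact: quot_quad. Qed.

(* T_k for 1 <= k <= n-1; the value 0 outside this range is never used. *)
Definition hecke_T (k : nat) : Hecke :=
  if k is k'.+1 then oapp hecke_gen 0 (insub k') else 0.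

End HeckeDef.

Section Diagram.
Local Open Scope nat_scope.

(* The list of the rows [a_i, b_i], from top to bottom. *)
Definition diagram := seq (int * int).
Implicit Type lam : diagram.

Definition row_size (ab : int * int) : nat := absz (ab.2 - ab.1 + 1)%R.

Definition degree lam : nat := \sum_(ab <- lam) row_size ab.

(* Rows are numbered from 1. *)
Definition row_start lam (i : nat) : int := (nth (0, 0)%R lam i.-1).1.
Definition row_end lam (i : nat) : int := (nth (0, 0)%R lam i.-1).2.

Definition cherednik lam : Prop :=
  (forall i, 1 <= i <= size lam -> (row_start lam i <= row_end lam i)%R) /\
  (forall i, 1 <= i < size lam ->
     (row_end lam i.+1 <= row_end lam i)%R \/
     (row_end lam i.+1 = row_end lam i + 1)%R /\
     (row_start lam i.+1 <= row_start lam i + 1)%R).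

(* In the order of the row filling, so that entry k-1 is the box filled with k. *)
Definition boxes lam : seq (nat * int) :=
  flatten [seq [seq (i, (row_start lam i + j%:Z)%R)
                 | j <- iota 0 (row_size (row_start lam i, row_end lam i))]
            | i <- iota 1 (size lam)].

Lemma size_boxes lam : size (boxes lam) = degree lam.
Proof.
rewrite size_flatten /shape -map_comp sumnE big_map /degree.
rewrite (big_nth (0, 0)%R) -[iota 1 _]/(iota (1 + 0) _) iotaDl big_map.
rewrite /index_iota subn0; apply: eq_bigr => i _.
by rewrite /= size_map size_iota /row_start /row_end /= -surjective_pairing.
Qed.

Definition parallel lam (k l : nat) : bool :=
  ((row_start lam k - k%:Z == row_start lam l - l%:Z) &&
   (row_end lam k - k%:Z == row_end lam l - l%:Z))%R.

Variable lam : diagram.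
Local Notation n := (degree lam).

(* [k : 'I_n] stands for the number k+1 of the row filling. *)
Definition box_of (k : 'I_n) : nat * int := nth (0, 0%R) (boxes lam) k.
Definition row_of (k : 'I_n) : nat := (box_of k).1.
Definition content (k : 'I_n) : int := ((box_of k).2 - (box_of k).1%:Z)%R.
Definition is_row_head (k : 'I_n) : bool :=
  (box_of k).2 == row_start lam (row_of k).

Definition parallel_heads (b : 'I_n * 'I_n) : bool :=
  [&& b.1 < b.2, is_row_head b.1, is_row_head b.2
    & parallel lam (row_of b.1) (row_of b.2)].

Definition inP (b : 'I_n * 'I_n) : bool := b.1 < b.2.

(* [true] when e(b) is the sign -, [false] when it is the sign +. *)
Definition e_minus (b : 'I_n * 'I_n) : bool :=
  let k := row_of b.1 in let l := row_of b.2 in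
  (row_end lam k - k%:Z == row_end lam l - l%:Z)%R.

Definition lt1 (b b' : 'I_n * 'I_n) : bool :=
  (b.1 < b'.1) || (b.1 == b'.1) && (b.2 < b'.2).
Definition lt2 (b b' : 'I_n * 'I_n) : bool :=
  (b.2 < b'.2) || (b.2 == b'.2) && (b.1 < b'.1).

(* Distinct blocks P_kl are compared by l first, then by k. *)
Definition special_lt (b b' : 'I_n * 'I_n) : bool :=
  let k := row_of b.1 in let l := row_of b.2 in
  let k' := row_of b'.1 in let l' := row_of b'.2 in
  if (k, l) == (k', l') then (if e_minus b then lt1 b b' else lt2 b b')
  else (l < l') || (l == l') && (k < k').

Definition special_seq : seq ('I_n * 'I_n) :=
  sort (fun b b' => (b == b') || special_lt b b')
       [seq b <- enum {: 'I_n * 'I_n} | inP b].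

Definition singular (b : 'I_n * 'I_n) : bool :=
  inP b && (content b.1 == content b.2).

Definition inR (b : 'I_n * 'I_n) : bool := singular b && ~~ parallel_heads b.

(* b' is b^+, respectively b^-. *)
Definition is_plus (b b' : 'I_n * 'I_n) : bool :=
  [&& b'.1 == b.1.+1 :> nat, row_of b'.1 == row_of b.1 & b'.2 == b.2].
Definition is_minus (b b' : 'I_n * 'I_n) : bool :=
  [&& b'.1 == b.1, b'.2.+1 == b.2 :> nat & row_of b'.2 == row_of b.2].

End Diagram.

Section Words.
Variable n : nat.

Lemma gen_lo_subproof (k : 'I_n.-1) : (k < n)%N.
Proof. exact: leq_trans (ltn_ord k) (leq_pred n). Qed.

Lemma gen_hi_subproof (k : 'I_n.-1) : (k.+1 < n)%N.
Proof. by case: n k => [|m] [k] //=; rewrite ltnS. Qed.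

Definition gen_lo (k : 'I_n.-1) : 'I_n := Ordinal (gen_lo_subproof k).
Definition gen_hi (k : 'I_n.-1) : 'I_n := Ordinal (gen_hi_subproof k).

Definition simple_refl (k : 'I_n.-1) : 'S_n := tperm (gen_lo k) (gen_hi k).

(* w s_k, i.e. i |-> w (s_k i); the product of perm.v composes in the opposite
   order. *)
Definition times_refl (w : 'S_n) (k : 'I_n.-1) : 'S_n := (simple_refl k * w)%g.

Definition word_perm (ks : seq 'I_n.-1) : 'S_n := foldl times_refl 1%g ks.

Definition reduced_decomposition (w : 'S_n) (ks : seq 'I_n.-1) : Prop :=
  word_perm ks = w /\ forall ks', word_perm ks' = w -> (size ks <= size ks')%N.

Definition longest_element (w0 : 'S_n) : Prop :=
  forall w ks ks0, reduced_decomposition w ks ->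
    reduced_decomposition w0 ks0 -> (size ks <= size ks0)%N.

End Words.

Section RegularValue.
Import mpoly.
Variables (K : fieldType) (H : lmodType K) (n : nat).

(* Value at x of an element of K[x_1, ..., x_n] (x) H, written as a sum of pure
   tensors. *)
Definition tensor_eval (P : seq ({mpoly K[n]} * H)) (x : 'I_n -> K) : H :=
  \sum_(t <- P) t.1.@[x] *: t.2.

(* The restriction to the affine variety V of a rational function f, with no pole
   on V /\ D, is regular at p with value v: there are polynomials Q, and P with
   coefficients in H, such that f = P / Q on V, Q(p) != 0 and v = P(p) / Q(p).
   The identity of rational functions f = P / Q is tested pointwise (as Q f = P)
   on V /\ D, which has to be Zariski dense in V; this holds below because the
   field K = C(q) is infinite. *)
Definition regular_value (V D : ('I_n -> K) -> Prop) (f : ('I_n -> K) -> H)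
    (p : 'I_n -> K) (v : H) : Prop :=
  exists (Q : {mpoly K[n]}) (P : seq ({mpoly K[n]} * H)),
    [/\ Q.@[p] != 0,
        forall x, V x -> D x -> Q.@[x] *: f x = tensor_eval P x
      & Q.@[p] *: v = tensor_eval P p].

End RegularValue.

Section Fusion.
Variables (K : fieldType) (q : K).

Definition angle (x : K) : K := (1 - q) / (1 - x).

Section Phi.
Variable n : nat.
Local Notation H := (Hecke q n).

Definition phi (k : 'I_n.-1) (x : 'I_n -> K) : H :=
  hecke_gen q k + (angle (x (gen_hi k) / x (gen_lo k)))%:A.

Definition twist (w : 'S_n) (psi : ('I_n -> K) -> H) (x : 'I_n -> K) : H :=
  psi (fun i => x (w i)).

Fixpoint phi_prod (w : 'S_n) (ks : seq 'I_n.-1) (x : 'I_n -> K) : H :=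
  if ks is k :: ks' then twist w (phi k) x * phi_prod (times_refl w k) ks' x
  else 1.

Definition phi0 (ks : seq 'I_n.-1) : ('I_n -> K) -> H := phi_prod 1%g ks.

End Phi.

Variable lam : diagram.
Local Notation n := (degree lam).
Local Notation H := (Hecke q n).
Local Notation T := (hecke_T q n).

Definition delta (x : 'I_n -> K) : K :=
  \prod_(b : 'I_n * 'I_n | parallel_heads b) (1 - x b.2 / x b.1).

Definition Fspace (x : 'I_n -> K) : Prop :=
  (forall k, x k != 0) /\
  (forall k l, row_of k = row_of l ->
     x k * q ^ content l = q ^ content k * x l).

Definition content_point (k : 'I_n) : K := q ^ content k.

(* The poles of phi0 on Fspace lie on the hyperplanes x_i = x_j, i <> j. *)
Definition is_E (ks : seq 'I_n.-1) (v : H) : Prop :=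
  regular_value Fspace (fun x => injective x)
    (fun x => delta x *: phi0 ks x) content_point v.

(* ks is a reduced decomposition of the longest element. The value v is unique, by
   density; the default 0 stands for the (non-occurring) non-regular case. *)
Definition E_element (ks : seq 'I_n.-1) : H := xget 0 [set v | is_E ks v].

Definition factor (b : 'I_n * 'I_n) : H :=
  if singular b && ~~ inR b then (1 - q)%:A
  else T (b.2 - b.1)
       + (angle (content_point b.2 / content_point b.1))%:A.

(* These stand for phi_(xi^-) phi_xi and for phi_xi phi_(xi^+), respectively. *)
Definition three_minus (xi : 'I_n * 'I_n) : H :=
  let k := (xi.2 - xi.1 - 1)%N in T k * T k.+1 - q *: T k.+1 - q%:A.
Definition three_plus (xi : 'I_n * 'I_n) : H :=
  let k := (xi.2 - xi.1 - 1)%N in T k.+1 * T k - q *: T k.+1 - q%:A.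

(* Left-to-right scan. A pair xi of R is adjacent to xi^e(xi) in the special order,
   and the blocks {xi, xi^e(xi)} are disjoint, so every xi of R is absorbed into a
   three-term factor and never reaches [factor]. *)
Fixpoint fused_factors (s : seq ('I_n * 'I_n)) : seq H :=
  match s with
  | [::] => [::]
  | b :: s1 =>
    match s1 with
    | [::] => [:: factor b]
    | b' :: s2 =>
      if [&& inR b', e_minus b' & is_minus b' b] then
        three_minus b' :: fused_factors s2
      else if [&& inR b, ~~ e_minus b & is_plus b b'] then
        three_plus b :: fused_factors s2
      else factor b :: fused_factors s1
    end
  end.

Definition fused_product : H := \prod_(h <- fused_factors (special_seq lam)) h.

End Fusion.

Definition Cq (R : realType) : fieldType := {fraction {poly R[i]}}.
Definition qvar (R : realType) : Cq R := tofrac ('X : {poly R[i]}).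

(* Main.v *)
Require Import Defs.
From HB Require Import structures.
From mathcomp Require Import all_boot all_order all_algebra perm.
From mathcomp Require Import reals.
From mathcomp Require Import ring zify.
From mathcomp Require classical_sets mpoly.

(** Write [F i j] for the elementary factor T_(j-i) + <x_j / x_i>.

    The product phi_0 does not depend on the reduced word: two reduced words are
    related by braid moves, and the factors satisfy the Yang-Baxter equation
    ([alg_phi0_reduced]).  The word (1 .. n-1)(1 .. n-2) .. (1) expresses phi_0 as the
    lexicographic product of the [F i j], i < j ([alg_phi0_longest]).  Two factors
    [F i j] and [F i' j'] with i < i' and j' < j commute, because the indices of their
    generators differ by at least 2.  Hence any order in which (i, j) never comes after
    (i', j') when i <= i' and j <= j' gives the same product ([compatible_prod]); the
    special order is one of these.

    On F_lambda the factor of a singular pair xi has a pole at the content point.  Let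
    xi = (i, j) with e(xi) = -, k = j - i - 1 and u = x_(j-1) / x_i, so that
    x_j / x_i = q u.  Then

      phi_(xi^-) phi_xi = T_k T_(k+1) + <u> T_(k+1) + <q u> (T_k + <u>),

    and only the last term has a pole.  The product R of the factors that follow
    satisfies T_k R = q R ([right_eigen]): the factor of (j-1, j) is T_1 + 1 on F_lambda,
    and the Yang-Baxter equation carries it to the front of R.  Since
    <q u> (q + <u>) = <u>, the pole cancels and

      phi_(xi^-) phi_xi R = (T_k T_(k+1) + <u> (T_(k+1) + 1)) R

    ([fuse_right]).  At the content point u = 1/q and <u> = -q, which is the three-term
    factor.  The case e(xi) = + is the mirror image: the product L of the factors that
    precede xi satisfies L T_k = q L ([left_eigen], [fuse_left]).

    The two kinds of replacement do not disturb each other.  The Cherednik condition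
    says that b_i - i is nonincreasing, so among the blocks P_1l, .., P_ll the blocks of
    sign + come first.  The relation T_k R = q R already holds for the part of R in these
    blocks, where all signs are then -.  So all pairs of sign + can be fused from right
    to left, with everything on their left intact, and then all pairs of sign - from left
    to right ([prod_item_fused]).

    What remains is regular at the content point, except for the factors of parallel row
    heads.  Such a factor, multiplied by its factor 1 - x_j / x_i of delta_lambda, is
    (1 - x_j / x_i) T_(j-i) + (1 - q), with value 1 - q ([regular_item]).

    Finally the value is unique ([regular_unique]).  The line of F_lambda with coordinates
    q^(c_k) (1 + q^(row of k) s) passes through the content point at s = 0, and for all
    but finitely many s its coordinates are nonzero and distinct.  A polynomial in s with
    coefficients in a vector space that vanishes for all but finitely many s vanishes at
    s = 0, by Lagrange interpolation of its scalar coefficients.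

    Everything up to the last part is proved in an arbitrary algebra with elements that
    satisfy the relations of the generators T_k. *)

Set Implicit Arguments.
Unset Strict Implicit.
Unset Printing Implicit Defensive.
Import GRing.Theory.
Local Open Scope ring_scope.

(** * The scalars <x> and two neighbouring generators *)

Section Relations.
Variables (K : fieldType) (q : K) (A : algType K).
Local Notation ang := (angle q).

(** The scalar identity behind the Yang-Baxter equation. *)
Lemma angle_mul (u v : K) : u != 1 -> v != 1 -> u * v != 1 ->
  ang (u * v) * (q - 1 + ang u + ang v) = ang u * ang v.
Proof.
rewrite /angle => u1 v1 uv1; field.
by rewrite !subr_eq0 ![1 == _]eq_sym u1 v1 uv1.
Qed.

Lemma angle_q (q1 : q != 1) : ang q = 1.
Proof. by rewrite /angle divff // subr_eq0 eq_sym. Qed.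

(** The cancellation of poles: <q u> has a pole at u = 1/q, but q + <u> vanishes
    there. *)
Lemma angle_qM (u : K) : u != 1 -> q * u != 1 ->
  ang (q * u) * (q + ang u) = ang u.
Proof.
rewrite /angle => u1 qu1; field.
by rewrite !subr_eq0 ![1 == _]eq_sym u1 qu1.
Qed.

Lemma angle_qV : q != 0 -> q != 1 -> ang q^-1 = - q.
Proof.
rewrite /angle => q0 q1; field.
by rewrite q0 subr_eq0 q1.
Qed.

Variables (s t : A).
Hypotheses (braid : s * t * s = t * s * t).
Hypotheses (quads : s * s = (q - 1) *: s + q%:A).
Hypotheses (quadt : t * t = (q - 1) *: t + q%:A).

Lemma yang_baxter (u v : K) : u != 1 -> v != 1 -> u * v != 1 ->
  (s + (ang u)%:A) * (t + (ang (u * v))%:A) * (s + (ang v)%:A) =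
  (t + (ang v)%:A) * (s + (ang (u * v))%:A) * (t + (ang u)%:A).
Proof.
move=> u1 v1 uv1; have := angle_mul u1 v1 uv1.
move: (ang u) (ang v) (ang _) => a b c abc.
rewrite !(mulrDl, mulrDr, mulr_algl, mulr_algr, scalerA) -!scalerAl braid quads quadt.
rewrite !scalerDr !scalerA.
rewrite [LHS](AC ((1*2)*2*(2*2)) (1*4*6*3*9*(2*5*7)*8)) /=.
rewrite [RHS](AC ((1*2)*2*(2*2)) (1*6*4*3*9*8*(2*5*7))) /=.
rewrite -!scalerDl.
have -> : c * (q - 1) + a * c + b * c = a * b by rewrite -abc; ring.
have -> : c * (q - 1) + b * c + a * c = b * a by rewrite [RHS]mulrC -abc; ring.
by congr (_ + _%:A + _ + _); ring.
Qed.

(** The hypothesis on [a] and [b] is the conclusion of [angle_qM] for a = <u> and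
    b = <q u>, and [y] stands for the product of the following factors. *)
Lemma fuse_right (a b : K) (y : A) : b * (q + a) = a -> s * y = q *: y ->
  (s + a%:A) * (t + b%:A) * y = (s * t + a *: (t + 1)) * y.
Proof.
move=> ba sy; rewrite [RHS]mulrDl -scalerAl [(t + 1) * y]mulrDl mul1r scalerDr.
rewrite -[X in _ = _ + (_ + X *: y)]ba.
rewrite !(mulrDl, mulrDr, mulr_algl, mulr_algr, scalerA, mul1r, scale1r).
rewrite -!scalerAl sy !scalerA scalerDl.
by rewrite (AC (2*2) (1*(3*(2*4)))) /= (mulrC b a).
Qed.

Lemma fuse_left (a b : K) (x : A) : a * (q + b) = b -> x * s = q *: x ->
  x * ((t + a%:A) * (s + b%:A)) = x * (t * s + b *: (t + 1)).
Proof.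
move=> ab xs; rewrite [RHS]mulrDr -scalerAr [x * (t + 1)]mulrDr mulr1 scalerDr.
rewrite -[X in _ = _ + (_ + X *: x)]ab.
rewrite !(mulrDl, mulrDr, mulr_algl, mulr_algr, scalerA, mul1r, scale1r).
rewrite -!scalerAr xs !scalerA scalerDl !mulrA.
by rewrite (AC (2*2) (1*(2*(3*4)))) /= (mulrC a q) (mulrC a b).
Qed.

(** The Yang-Baxter equation with one of the three parameters equal to q, where the
    factor of that parameter is s + 1: here (q + 1) y = (s + 1) y plays its role. *)
Lemma eigen_absorb_right (a b : K) (y : A) : b * (q + a) = a -> s * y = q *: y ->
  t * ((s + a%:A) * (t + b%:A) * y) = q *: ((s + a%:A) * (t + b%:A) * y).
Proof.
move=> ba sy; rewrite fuse_right // mulrDl -scalerAl mulrDl mul1r scalerDr addrA.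
rewrite !mulrDr -!scalerAr !mulrA -braid quadt -(mulrA _ s y) sy -scalerAr.
rewrite mulrDl mulr_algl -scalerAl !scalerDr !scalerA -!addrA; congr (_ + _).
by rewrite addrA addrAC -scalerDl (mulrC q a); congr (_ *: _ + _); ring.
Qed.

Lemma eigen_absorb_left (a b : K) (x : A) : a * (q + b) = b -> x * s = q *: x ->
  x * ((t + a%:A) * (s + b%:A)) * t = q *: (x * ((t + a%:A) * (s + b%:A))).
Proof.
move=> ab xs; rewrite fuse_left // mulrDr -scalerAr mulrDr mulr1 scalerDr addrA mulrA.
rewrite !mulrDl -!scalerAl -!(mulrA x) -braid quadt (mulrA x (s * t)) (mulrA x s) xs.
rewrite -!scalerAl -(mulrA x t s).
rewrite mulrDr mulr_algr -scalerAr !scalerDr !scalerA -!addrA; congr (_ + _).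
by rewrite addrA addrAC -scalerDl (mulrC q b); congr (_ *: _ + _); ring.
Qed.
End Relations.

(** * Products in an order compatible with the product order on pairs *)

Section IncreasingProducts.
Variables (A : nzRingType) (F : nat -> nat -> A).
Hypothesis comF : forall i j i' j', (i < i')%N -> (i' < j')%N -> (j' < j)%N ->
  F i j * F i' j' = F i' j' * F i j.

Definition below (b c : nat * nat) := ((b.1 <= c.1) && (b.2 <= c.2))%N.
(** A later pair is never below an earlier one in the product order. *)
Definition compatible (s : seq (nat * nat)) :=
  pairwise (fun b c => ~~ below c b) s.

Lemma comm_prod (I : Type) (r : seq I) (P : pred I) (G : I -> A) (x : A) :
  (forall i, P i -> GRing.comm x (G i)) -> GRing.comm x (\prod_(i <- r | P i) G i).
Proof.
move=> H; elim/big_ind: _ => //; first exact: commr1.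
by move=> *; apply: commrM.
Qed.

Lemma comm_prod_seq (I : eqType) (r : seq I) (G : I -> A) (x : A) :
  (forall i, i \in r -> GRing.comm x (G i)) -> GRing.comm x (\prod_(i <- r) G i).
Proof. by move=> H; rewrite big_seq; apply: comm_prod. Qed.

(** Bring the first factor of [s] to the front of [s']: the factors that it crosses are
    incomparable to it in the product order, so [comF] applies to them. *)
Lemma compatible_prod (s s' : seq (nat * nat)) :
  {in s, forall b, b.1 < b.2}%N -> compatible s -> compatible s' -> perm_eq s s' ->
  \prod_(b <- s) F b.1 b.2 = \prod_(b <- s') F b.1 b.2.
Proof.
elim: s s' => [|b s IH] s' lt_s; first by move=> _ _ /perm_size; case: s'.
rewrite /compatible /= => /andP[/allP bs ps] ps' pe.
have bs' : b \in s' by rewrite -(perm_mem pe) mem_head.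
move: ps' pe; case/splitPr: s' / bs' => u v ps' pe.
have {}pe : perm_eq s (u ++ v)
  by rewrite -(perm_cons b) (perm_trans pe) // perm_catC /= perm_cons perm_catC.
move: ps'; rewrite pairwise_cat /= => /and4P[/allrelP uv pu bv pv].
rewrite big_cons (IH (u ++ v)) //; first last.
- rewrite /compatible pairwise_cat pu pv !andbT; apply/allrelP => c d cu dv.
  by apply: uv => //; rewrite inE dv orbT.
- by move=> c cs; apply: lt_s; rewrite inE cs orbT.
rewrite !big_cat big_cons /= !mulrA; congr (_ * _).
apply: comm_prod_seq => c cu.
have cs : c \in s by rewrite (perm_mem pe) mem_cat cu.
have := bs c cs; have := uv c b cu (mem_head _ _).
have := lt_s c; rewrite inE cs orbT => /(_ isT).
have := lt_s b (mem_head _ _).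
case: b c {IH lt_s bs pe uv bv cu cs} => [i j] [i' j'] /=.
rewrite /below /= => ij ij' H1 H2.
have [ii|ii] := ltnP i i'.
  by apply: comF => //; lia.
by apply/esym/comF => //; lia.
Qed.

Lemma prod_pairs (r r' : seq nat) (G : nat -> nat -> A) (P : nat -> nat -> bool) :
  \prod_(b <- [seq (i, j) | i <- r, j <- [seq j <- r' | P i j]]) G b.1 b.2 =
  \prod_(i <- r) \prod_(j <- r' | P i j) G i j.
Proof.
elim: r => [|i r IH] /=; first by rewrite !big_nil.
rewrite big_cat IH big_cons big_map /=; congr (_ * _).
by rewrite big_filter.
Qed.

Variable n : nat.

Definition pairs_of (P : nat -> nat -> bool) : seq (nat * nat) :=
  [seq (i, j) | i <- iota 0 n, j <- [seq j <- iota 0 n | P i j]].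

Lemma mem_pairs_of P i j : ((i, j) \in pairs_of P) = [&& (i < n)%N, (j < n)%N & P i j].
Proof.
apply/allpairsPdep/and3P => [[i' [j' [+ + [-> ->]]]]|[il jl Pij]].
  by rewrite mem_filter !mem_iota /= => -> /andP[-> ->].
by exists i, j; rewrite mem_filter !mem_iota /= il jl Pij.
Qed.

Lemma pairs_of_uniq P : uniq (pairs_of P).
Proof.
apply: allpairs_uniq_dep; rewrite ?iota_uniq //.
  by move=> i _; rewrite filter_uniq ?iota_uniq.
by move=> [i j] [i' j'] _ _ /= [-> ->].
Qed.

Lemma pairs_of_pairwise (e : rel (nat * nat)) P :
  (forall i i' j j', (i < i')%N -> e (i, j) (i', j')) ->
  (forall i j j', (j < j')%N -> e (i, j) (i, j')) -> pairwise e (pairs_of P).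
Proof.
move=> e1 e2; rewrite /pairs_of; move: (iota_ltn_sorted 0 n).
elim: {1 3}(iota 0 n) => //= i r IH; rewrite (path_sortedE ltn_trans) => /andP[/allP ir /IH pr].
rewrite pairwise_cat pr andbT; apply/andP; split.
  by apply/allrelP => b c /mapP[j _ ->] /allpairsPdep[i' [j' [/ir ii' _ ->]]]; apply: e1.
rewrite pairwise_map; apply: (@sub_pairwise _ ltn) => [j j' jj|]; first exact: e2.
rewrite -(sorted_pairwise ltn_trans); apply: sorted_filter; first exact: ltn_trans.
exact: iota_ltn_sorted.
Qed.

Lemma compatible_uniq s : compatible s -> uniq s.
Proof.
elim: s => //= b s IH; rewrite /compatible /= => /andP[/allP bs /IH ->].
by rewrite andbT; apply/negP => /bs; rewrite /below !leqnn.
Qed.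

Lemma prod_lex (s : seq (nat * nat)) :
  {in s, forall b, b.1 < b.2 < n}%N -> compatible s ->
  \prod_(b <- s) F b.1 b.2 =
  \prod_(0 <= i < n) \prod_(0 <= j < n | (i, j) \in s) F i j.
Proof.
move=> lt_s cs; rewrite /index_iota subn0 -prod_pairs -/(pairs_of _).
apply: compatible_prod => //; first by move=> b /lt_s /andP[].
  apply: pairs_of_pairwise => [i i' j j' ii|i j j' jj]; rewrite /below /=.
    by rewrite leqNgt ii.
  by rewrite leqnn -ltnNge.
apply: uniq_perm; rewrite ?(compatible_uniq cs) ?pairs_of_uniq // => -[i j].
rewrite mem_pairs_of; apply/idP/and3P => [ijs|[]//].
by have /= := lt_s _ ijs; split=> //; lia.
Qed.

Lemma prod_colex (s : seq (nat * nat)) :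
  {in s, forall b, b.1 < b.2 < n}%N -> compatible s ->
  \prod_(b <- s) F b.1 b.2 =
  \prod_(0 <= j < n) \prod_(0 <= i < n | (i, j) \in s) F i j.
Proof.
move=> lt_s cs; rewrite /index_iota subn0.
rewrite -(prod_pairs _ _ (fun j i => F i j) (fun j i => (i, j) \in s)) -/(pairs_of _).
pose swap (b : nat * nat) := (b.2, b.1).
rewrite -[RHS](big_map swap xpredT (fun b => F b.1 b.2)).
apply: compatible_prod => //; first by move=> b /lt_s /andP[].
  rewrite /compatible pairwise_map.
  apply: pairs_of_pairwise => [j j' i i' jj|j i i' ii]; rewrite /below /=.
    by rewrite andbC leqNgt jj.
  by rewrite leqnn andbT -ltnNge.
have swapK : cancel swap swap by case.
apply: uniq_perm; rewrite ?(compatible_uniq cs) ?(map_inj_uniq (can_inj swapK)) ?pairs_of_uniq //.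
move=> [i j]; rewrite -[(i, j)]swapK (mem_map (can_inj swapK)) mem_pairs_of.
apply/idP/and3P => [ijs|[]//].
by have /= := lt_s _ ijs; split=> //; lia.
Qed.

End IncreasingProducts.

(** * Reduced words in the symmetric group *)

Section Words.
Variable n : nat.
Implicit Types (p w : 'S_n) (k l : 'I_n.-1) (ks : seq 'I_n.-1).
Local Notation s := (@simple_refl n).

Lemma simple_reflK k : (s k * s k = 1)%g.
Proof. exact: tperm2. Qed.

Lemma simple_refl_lo k : s k (gen_lo k) = gen_hi k.
Proof. exact: tpermL. Qed.
Lemma simple_refl_hi k : s k (gen_hi k) = gen_lo k.
Proof. exact: tpermR. Qed.

Lemma simple_reflE k (i : 'I_n) :
  s k i = (if i == k :> nat then k.+1 else if i == k.+1 :> nat then k : nat else i) :> nat.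
Proof.
rewrite /simple_refl; case: tpermP => [->|->|/eqP + /eqP] /=; rewrite ?eqxx //.
  by case: eqP => //; lia.
by rewrite -!val_eqE /= => /negbTE-> /negbTE->.
Qed.

Lemma simple_refl_id k (i : 'I_n) : (i != k :> nat) && (i != k.+1 :> nat) -> s k i = i.
Proof.
by move=> /andP[/negbTE ik /negbTE ik1]; apply/val_inj; rewrite /= simple_reflE ik ik1.
Qed.

Lemma simple_refl_comm k l : (k.+1 < l)%N || (l.+1 < k)%N -> (s k * s l = s l * s k)%g.
Proof.
move=> kl; apply/permP => i; apply/val_inj; rewrite !permM /= !simple_reflE.
by repeat case: ifP; lia.
Qed.

Lemma simple_refl_braid k l : l = k.+1 :> nat -> (s k * s l * s k = s l * s k * s l)%g.
Proof.
move=> kl; have e : gen_lo l = gen_hi k by apply: val_inj.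
have -> : (s k * s l * s k = s l ^ s k)%g by rewrite conjgE tpermV mulgA.
have -> : (s l * s k * s l = s k ^ s l)%g by rewrite conjgE tpermV mulgA.
have fk : s k (gen_hi l) = gen_hi l by apply: simple_refl_id => /=; lia.
have fl : s l (gen_lo k) = gen_lo k by apply: simple_refl_id => /=; lia.
rewrite [in LHS](_ : s l = tperm (gen_lo l) (gen_hi l)) // tpermJ fk e simple_refl_hi.
by rewrite [in RHS](_ : s k = tperm (gen_lo k) (gen_hi k)) // tpermJ fl -e simple_refl_lo.
Qed.

(** The inversions of [p]; it is applied to inverses of permutations, for which
    multiplication by [s k] on the left changes adjacent positions. *)
Definition inversions p := #|[set b : 'I_n * 'I_n | (b.1 < b.2)%N && (p b.2 < p b.1)%N]|.

(** The involution [s k] on positions is a bijection between the inversions of [p] other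
    than that of positions k, k+1 and the inversions of [s k * p]. *)
Lemma inversions_descent p k : (p (gen_hi k) < p (gen_lo k))%N ->
  inversions p = (inversions (s k * p)%g).+1.
Proof.
move=> dk; rewrite /inversions.
set D := [set b | _ & (p _ < _)%N]; set D' := [set b | _ & _].
pose f (b : 'I_n * 'I_n) := (s k b.1, s k b.2).
have ff : involutive f.
  by move=> [i j]; rewrite /f /= -!permM simple_reflK !perm1.
have -> : D = (gen_lo k, gen_hi k) |: (f @: D').
  apply/setP => -[i j]; rewrite in_setU1.
  have -> : ((i, j) \in f @: D') = ((i, j) \in f @^-1: D').
    by rewrite (can2_imset_pre _ ff ff).
  rewrite !inE xpair_eqE /= !permM !(tpermK (gen_lo k)) !simple_reflE -!val_eqE /=.
  have := ltn_ord k; move: (@val_inj _ _ _ i (gen_lo k)) (@val_inj _ _ _ j (gen_hi k)).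
  move: (@val_inj _ _ _ i (gen_lo k)) (@val_inj _ _ _ j (gen_hi k)).
  have [/andP[/eqP ik /eqP jk]|] := boolP ((i == k :> nat) && (j == k.+1 :> nat)).
    by move=> il jh _; rewrite (il ik) (jh jk) /= ltnSn dk.
  move=> nij _ _; move: (@val_inj _ _ _ i (gen_hi k)) (@val_inj _ _ _ j (gen_lo k)).
  have [/andP[/eqP ik /eqP jk]|] := boolP ((i == k.+1 :> nat) && (j == k :> nat)).
    move=> ih jl _; rewrite (ih ik) (jl jk) /=.
    move=> _ _; have -> : (p (gen_lo k) < p (gen_hi k))%N = false by lia.
    by rewrite !andbF.
  move=> nji _ _ _; case: (p j < p i)%N; rewrite ?andbF ?orbF ?andbT //= => _ _.
  by repeat case: ifP; lia.
rewrite cardsU1 (card_imset _ (inv_inj ff)) (can2_imset_pre _ ff ff) !inE /=.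
by rewrite simple_refl_lo simple_refl_hi /= ltnNge leqnSn.
Qed.

Lemma inversions_ascent p k : (p (gen_lo k) < p (gen_hi k))%N ->
  inversions (s k * p)%g = (inversions p).+1.
Proof.
move=> ak; rewrite (inversions_descent (k := k)) ?mulgA ?simple_reflK ?mul1g //.
by rewrite !permM simple_refl_lo simple_refl_hi.
Qed.

(** The inverse of [word_perm ks] ([word_invE]); unlike [word_perm] it is recursive from
    the first letter, which is the letter that the induction of [alg_phi0_reduced]
    removes. *)
Definition word_inv ks : 'S_n := foldr (fun k p => s k * p)%g 1%g ks.

Lemma foldl_times_refl w ks : foldl (@times_refl n) w ks = (word_perm ks * w)%g.
Proof.
rewrite /word_perm; elim: ks w => [|k ks IH] w /=; first by rewrite mul1g.
by rewrite IH [in RHS]IH /times_refl mulg1 !mulgA.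
Qed.

Lemma word_perm_cons k ks : word_perm (k :: ks) = (word_perm ks * s k)%g.
Proof. by rewrite {1}/word_perm /= foldl_times_refl /times_refl mulg1. Qed.

Lemma word_perm_cat ks ks' : word_perm (ks ++ ks') = (word_perm ks' * word_perm ks)%g.
Proof. by rewrite {1}/word_perm foldl_cat foldl_times_refl. Qed.

Lemma word_invE ks : word_inv ks = (word_perm ks)^-1%g.
Proof.
elim: ks => [|k ks IH]; first by rewrite /word_perm /= invg1.
by rewrite word_perm_cons invgM /= IH tpermV.
Qed.

Lemma gen_neq k : gen_lo k != gen_hi k.
Proof. by rewrite -val_eqE /= neq_ltn leqnn. Qed.

Lemma neq_perm_ltn p k : ((p (gen_lo k) < p (gen_hi k)) || (p (gen_hi k) < p (gen_lo k)))%N.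
Proof.
by rewrite -neq_ltn; apply: contra (gen_neq k) => /eqP/val_inj/perm_inj ->.
Qed.

Lemma inversions_le_size ks : (inversions (word_inv ks) <= size ks)%N.
Proof.
elim: ks => [|k ks IH] /=.
  rewrite leqn0 cards_eq0; apply/eqP/setP => -[i j]; rewrite !inE !perm1 /=.
  by apply/negP; lia.
case/orP: (neq_perm_ltn (word_inv ks) k) => [/inversions_ascent ->|/inversions_descent e].
  exact: IH.
by rewrite (leq_trans _ (leqW IH)) // e ltnW.
Qed.

(** Such a [p] and its inverse are increasing, and an increasing permutation satisfies
    i <= p i. *)
Lemma no_descent p : (forall k, p (gen_lo k) < p (gen_hi k))%N -> p = 1%g.
Proof.
move=> asc.
have mono (i j : 'I_n) : (i < j)%N -> (p i < p j)%N.
  move: {2}(j - i)%N (erefl (j - i)%N) => d; elim: d j => [|d IH] j ijd ij; first by lia.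
  have j1 : (j.-1 < n.-1)%N by have := ltn_ord j; lia.
  have := asc (Ordinal j1).
  have -> : gen_hi (Ordinal j1) = j by apply: val_inj => /=; lia.
  have [->//|ij1] := eqVneq i (gen_lo (Ordinal j1)).
  apply: ltn_trans; apply: IH => /=; first by lia.
  by move: ij1; rewrite -val_eqE /=; lia.
have mono' (i j : 'I_n) : (i < j)%N -> (p^-1 i < p^-1 j)%g%N.
  move=> ij; rewrite ltnNge leq_eqVlt; apply/negP => /orP[/eqP/val_inj/perm_inj e|/mono].
    by rewrite e ltnn in ij.
  by rewrite !permKV; lia.
have ge (r : 'S_n) : (forall i j : 'I_n, i < j -> r i < r j)%N -> forall i : 'I_n, (i <= r i)%N.
  move=> mr [i]; elim: i => //= i IH ilt.
  have i1 : (i < n)%N by apply: ltnW.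
  by apply: leq_ltn_trans (IH i1) _; apply: mr => /=.
apply/permP => i; rewrite perm1; apply/val_inj/eqP; rewrite eqn_leq.
by rewrite ge // andbT; have := ge _ mono' (p i); rewrite permK.
Qed.

Lemma word_exists p : {ks | word_inv ks = p & size ks = inversions p}.
Proof.
move: {2}(inversions p) (erefl (inversions p)) => m; elim: m p => [|m IH] p pm.
  exists [::] => //=; apply/esym/no_descent => k.
  case/orP: (neq_perm_ltn p k) => // /inversions_descent; lia.
case: (pickP (fun k => p (gen_hi k) < p (gen_lo k))%N) => [k dk|nd].
  have [|ks e sz] := IH (s k * p)%g; first by have := inversions_descent dk; lia.
  exists (k :: ks) => /=; first by rewrite e mulgA simple_reflK mul1g.
  by rewrite sz (inversions_descent dk).
suff p1 : p = 1%g by have := inversions_le_size [::]; rewrite /= -p1 pm.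
by apply: no_descent => k; case/orP: (neq_perm_ltn p k) => //; rewrite nd.
Qed.

Lemma reduced_size w ks : reduced_decomposition w ks -> size ks = inversions w^-1%g.
Proof.
move=> [ew min]; apply/eqP; rewrite eqn_leq -{2}ew -word_invE inversions_le_size andbT.
have [ks' e <-] := word_exists w^-1%g; apply: min.
by apply: invg_inj; rewrite -word_invE.
Qed.

Lemma inversions_word_cons k ks m : size ks = m -> inversions (word_inv (k :: ks)) = m.+1 ->
  inversions (word_inv ks) = m /\
  (word_inv (k :: ks) (gen_hi k) < word_inv (k :: ks) (gen_lo k))%N.
Proof.
set p := word_inv (k :: ks).
move=> sz np; have := inversions_le_size ks; rewrite sz => le.
case/orP: (neq_perm_ltn p k) => [a|d].
  have := inversions_ascent a; rewrite /p /= mulgA simple_reflK mul1g.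
  by rewrite -/(word_inv (k :: ks)) -/p np; lia.
by have := inversions_descent d; rewrite np /p /= mulgA simple_reflK mul1g => -[->].
Qed.

End Words.

(** * Independence of the reduced word *)

Section Matsumoto.
Variables (K : fieldType) (q : K) (n : nat) (A : algType K) (t : 'I_n.-1 -> A).
Local Notation ang := (angle q).

(** The factors phi_k and the product phi_0, with [t] in place of the generators. *)
Definition alg_phi (k : 'I_n.-1) (x : 'I_n -> K) : A :=
  t k + (ang (x (gen_hi k) / x (gen_lo k)))%:A.
Fixpoint alg_phi_prod (w : 'S_n) (ks : seq 'I_n.-1) (x : 'I_n -> K) : A :=
  if ks is k :: ks' then alg_phi k (fun i => x (w i)) * alg_phi_prod (times_refl w k) ks' x
  else 1.
Definition alg_T (k : nat) : A :=
  if k is k'.+1 then oapp t 0 (insub k') else 0.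

Lemma alg_phi_prod_comp (u w : 'S_n) ks x :
  alg_phi_prod (u * w)%g ks x = alg_phi_prod u ks (fun i => x (w i)).
Proof.
elim: ks u => [|k ks IH] u //=; rewrite /times_refl mulgA -IH; congr (_ * _).
by rewrite /alg_phi !permM.
Qed.

Local Notation alg_phi0 := (alg_phi_prod 1%g).

Lemma alg_phi0_cat (ks ks' : seq 'I_n.-1) x :
  alg_phi0 (ks ++ ks') x = alg_phi0 ks x * alg_phi0 ks' (fun i => x (word_perm ks i)).
Proof.
have H w : alg_phi_prod w (ks ++ ks') x =
    alg_phi_prod w ks x * alg_phi_prod (word_perm ks * w)%g ks' x.
  elim: ks w => [|k ks IH] w /=; first by rewrite mul1r /word_perm /= mul1g.
  by rewrite IH mulrA word_perm_cons /times_refl mulgA.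
by rewrite H mulg1 -[word_perm ks in LHS]mul1g alg_phi_prod_comp.
Qed.

(** The form of phi_0 used in inductions: it removes the first letter at the cost of
    permuting the point. *)
Lemma alg_phi0_cons k (ks : seq 'I_n.-1) x :
  alg_phi0 (k :: ks) x = alg_phi k x * alg_phi0 ks (fun i => x (simple_refl k i)).
Proof.
rewrite -alg_phi_prod_comp /= /times_refl mulg1 mul1g; congr (_ * _).
by rewrite /alg_phi !perm1.
Qed.

Lemma alg_phi0_ext (ks : seq 'I_n.-1) x y : x =1 y -> alg_phi0 ks x = alg_phi0 ks y.
Proof.
move=> xy; elim: ks 1%g => //= k ks IH w; rewrite IH; congr (_ * _).
by rewrite /alg_phi !xy.
Qed.

Lemma alg_phi0_nil x : alg_phi0 [::] x = 1.
Proof. by []. Qed.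

Arguments alg_phi_prod : simpl never.

Hypothesis braidT : forall k l : 'I_n.-1, l = k.+1 :> nat -> t k * t l * t k = t l * t k * t l.
Hypothesis commT : forall k l : 'I_n.-1, (k.+1 < l)%N || (l.+1 < k)%N -> t k * t l = t l * t k.
Hypothesis quadT : forall k, (t k - q%:A) * (t k + 1) = 0.

Lemma gen_sqr k : t k * t k = (q - 1) *: t k + q%:A.
Proof.
have := quadT k; rewrite mulrBl !mulrDr !mulr1 mulr_algl => /eqP.
rewrite subr_eq0 => /eqP e; apply: (addIr (t k)); rewrite e.
by rewrite addrAC -{3}[t k]scale1r -scalerDl subrK.
Qed.

(** The points at which all factors are defined by their formula. *)
Definition generic (x : 'I_n -> K) := injective x /\ forall i, x i != 0.

Lemma generic_perm x (p : 'S_n) : generic x -> generic (fun i => x (p i)).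
Proof. by move=> [ix nx]; split=> // i j /ix /perm_inj. Qed.

Lemma generic_neq1 x i j : generic x -> i != j -> x i / x j != 1.
Proof.
move=> [ix nx]; apply: contra => /eqP e.
by apply/eqP/ix; rewrite -[LHS](divfK (nx j)) e mul1r.
Qed.

(** In terms of ratios of coordinates the three parameters on the left are u, u v and v
    with u = x_(k+1) / x_k and v = x_(k+2) / x_(k+1). *)
Lemma alg_phi_yang_baxter x (k l : 'I_n.-1) : generic x -> l = k.+1 :> nat ->
  forall z, alg_phi0 [:: k, l, k & z] x = alg_phi0 [:: l, k, l & z] x.
Proof.
move=> gx kl z.
have split3 a b c : [:: a, b, c & z] = [:: a; b; c] ++ z by [].
rewrite !split3 !alg_phi0_cat; congr (_ * _); last first.
  apply: alg_phi0_ext => i; rewrite !word_perm_cons.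
  by rewrite [word_perm [::]]/(1%g) !mul1g (simple_refl_braid kl).
have ab : gen_hi k != gen_lo k by rewrite eq_sym gen_neq.
have lk : gen_lo l = gen_hi k by apply: val_inj.
have bc : gen_hi l != gen_hi k by rewrite -lk eq_sym gen_neq.
have ac : gen_hi l != gen_lo k by rewrite -val_eqE /= kl; lia.
have skc : simple_refl k (gen_hi l) = gen_hi l.
  by apply: simple_refl_id => /=; lia.
have sla : simple_refl l (gen_lo k) = gen_lo k.
  by apply: simple_refl_id => /=; lia.
have slb : simple_refl l (gen_hi k) = gen_hi l by rewrite -lk simple_refl_lo.
rewrite !alg_phi0_cons !alg_phi0_nil !mulr1 !mulrA /alg_phi /=.
rewrite !lk !slb !sla !skc !simple_refl_hi !simple_refl_lo !lk sla.
have -> : x (gen_hi l) / x (gen_lo k) =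
    (x (gen_hi k) / x (gen_lo k)) * (x (gen_hi l) / x (gen_hi k)).
  by case: gx => _ nx; field; rewrite !nx.
apply: yang_baxter; rewrite ?gen_sqr ?generic_neq1 //; first exact: braidT.
have -> : (x (gen_hi k) / x (gen_lo k)) * (x (gen_hi l) / x (gen_hi k)) =
    x (gen_hi l) / x (gen_lo k).
  by case: gx => _ nx; field; rewrite !nx.
exact: generic_neq1.
Qed.

Lemma alg_phi_comm x (k l : 'I_n.-1) z : (k.+1 < l)%N || (l.+1 < k)%N ->
  alg_phi0 [:: k, l & z] x = alg_phi0 [:: l, k & z] x.
Proof.
move=> kl.
have fix2 (k' l' : 'I_n.-1) : (k'.+1 < l')%N || (l'.+1 < k')%N ->
    simple_refl k' (gen_lo l') = gen_lo l' /\ simple_refl k' (gen_hi l') = gen_hi l'.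
  by move=> kl'; split; apply: simple_refl_id => /=; lia.
have [e1 e2] := fix2 k l kl; have [e3 e4] : _ /\ _ := fix2 l k ltac:(lia).
rewrite !alg_phi0_cons !mulrA; congr (_ * _); last first.
  by apply: alg_phi0_ext => i; rewrite -!permM (simple_refl_comm kl).
rewrite /alg_phi e1 e2 e3 e4 !(mulrDl, mulrDr, mulr_algl, mulr_algr, scalerA) commT //.
by rewrite [LHS]addrACA [RHS]addrA (mulrC (ang _)) [LHS]addrA.
Qed.

(** Matsumoto's argument.  If the words start with different letters k and l, then both
    are left descents of the permutation, which therefore has reduced words starting with
    k l .. and l k .. (or with k l k .. and l k l ..).  By induction the two words may be
    replaced by these, which differ by a commutation or a Yang-Baxter move. *)
Lemma alg_phi0_reduced m (ks ks' : seq 'I_n.-1) x : generic x ->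
  size ks = m -> size ks' = m -> word_inv ks = word_inv ks' ->
  inversions (word_inv ks) = m -> alg_phi0 ks x = alg_phi0 ks' x.
Proof.
elim/ltn_ind: m ks ks' x => -[|m] IH [|k u] [|l v] x gx //= [su] [sv] e nm.
have [nu dk] := inversions_word_cons su nm.
have [nv dl] : _ /\ _ := inversions_word_cons sv (etrans (congr1 _ (esym e)) nm).
rewrite /= -e in dl; move: dk dl e nm => /=.
move: (erefl (simple_refl k * word_inv u)%g).
move: {-1}(simple_refl k * word_inv u)%g => p e0 dk dl e nm.
have eu : word_inv u = (simple_refl k * p)%g by rewrite -e0 mulgA simple_reflK mul1g.
have ev : word_inv v = (simple_refl l * p)%g by rewrite e mulgA simple_reflK mul1g.
move=> {e0 e}; wlog kl : k l u v su sv nu nv p dk dl nm eu ev / (k <= l)%N.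
  move=> W; case/orP: (leq_total k l) => [|lk]; first exact: (W k l u v su sv nu nv p).
  by apply/esym; apply: (W l k v u sv su nv nu p).
have use (w w' : seq 'I_n.-1) (y : 'I_n -> K) : generic y -> size w = m ->
    word_inv w' = word_inv w -> size w' = m ->
    inversions (word_inv w) = m -> alg_phi0 w y = alg_phi0 w' y.
  by move=> gy sw ew sw' nw; apply: (IH m) => //.
have [ekl|nkl] := eqVneq (k : nat) l.
  move/val_inj: ekl => ekl; subst l; rewrite !alg_phi0_cons; congr (_ * _).
  by apply: use => //; [exact: generic_perm | rewrite eu ev].
have [lk1|lk1] := eqVneq (l : nat) k.+1; last first.
  have kl2 : (k.+1 < l)%N || (l.+1 < k)%N by lia.
  pose p' := (simple_refl l * (simple_refl k * p))%g.
  have [z ez sz] := word_exists p'.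
  have skl : simple_refl k (gen_lo l) = gen_lo l /\ simple_refl k (gen_hi l) = gen_hi l.
    by split; apply: simple_refl_id => /=; lia.
  have np' : inversions (simple_refl k * p)%g = (inversions p').+1.
    by apply: inversions_descent; rewrite !permM skl.1 skl.2.
  have s1 : size (l :: z) = m by rewrite /= sz -np' -eu.
  have s2 : size (k :: z) = m by [].
  rewrite alg_phi0_cons (use u (l :: z) _ (generic_perm _ gx)) //; last first.
    by rewrite /= ez /p' mulgA simple_reflK mul1g.
  rewrite [RHS]alg_phi0_cons (use v (k :: z) _ (generic_perm _ gx)) //; last first.
    rewrite /= ez /p' ev !mulgA -(mulgA (simple_refl k)) -(simple_refl_comm kl2).
    by rewrite mulgA simple_reflK mul1g.
  by rewrite -!alg_phi0_cons; apply: alg_phi_comm.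
pose p' := (simple_refl k * (simple_refl l * (simple_refl k * p)))%g.
have [z ez sz] := word_exists p'.
have lk : gen_lo l = gen_hi k by apply: val_inj.
have skc : simple_refl k (gen_hi l) = gen_hi l.
  by apply: simple_refl_id => /=; lia.
have sla : simple_refl l (gen_lo k) = gen_lo k.
  by apply: simple_refl_id => /=; lia.
have slb : simple_refl l (gen_hi k) = gen_hi l by rewrite -lk simple_refl_lo.
rewrite lk in dl.
have np1 : inversions (simple_refl k * p)%g =
    (inversions (simple_refl l * (simple_refl k * p))%g).+1.
  apply: inversions_descent; rewrite !permM skc lk simple_refl_hi.
  exact: ltn_trans dl dk.
have np2 : inversions (simple_refl l * (simple_refl k * p))%g = (inversions p').+1.
  by apply: inversions_descent; rewrite !permM sla slb skc simple_refl_lo.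
have s1 : size [:: l, k & z] = m by rewrite /= sz -np2 -np1 -eu.
have s2 : size [:: k, l & z] = m by [].
rewrite alg_phi0_cons (use u [:: l, k & z] _ (generic_perm _ gx)) //; last first.
  by rewrite /= ez /p' eu !mulgA -(mulgA (simple_refl l)) simple_reflK mulg1 simple_reflK mul1g.
rewrite [RHS]alg_phi0_cons (use v [:: k, l & z] _ (generic_perm _ gx)) //; last first.
  rewrite /= ez /p' ev !mulgA -[(simple_refl k * _ * _ * _ * _)%g]mulgA.
  rewrite (simple_refl_braid lk1) !mulgA -(mulgA _ (simple_refl l) (simple_refl l)).
  rewrite (simple_reflK l) mulg1 -(mulgA _ (simple_refl k) (simple_refl k)).
  by rewrite (simple_reflK k) mulg1.
by rewrite -!alg_phi0_cons; apply: alg_phi_yang_baxter.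
Qed.

(** The coordinates as a sequence; the value 1 beyond the last one keeps them nonzero. *)
Definition ext (x : 'I_n -> K) (k : nat) : K := oapp x 1 (insub k).

Lemma ext_val x (i : 'I_n) : ext x i = x i.
Proof. by rewrite /ext valK. Qed.

Definition pair_factor (x : 'I_n -> K) (i j : nat) : A :=
  alg_T (j - i) + (ang (ext x j / ext x i))%:A.

(** The word k, k+1, .., m-2 moves the coordinate x_k past x_(k+1), .., x_(m-1). *)
Lemma row_word k m : (k < m <= n)%N -> exists ks : seq 'I_n.-1,
  [/\ size ks = (m.-1 - k)%N,
      forall i, word_perm ks i = (if (k <= i < m.-1)%N then i.+1 else
                                 if i == m.-1 :> nat then k else i) :> nat
    & forall x, alg_phi0 ks x =
        \prod_(k.+1 <= j < m) (alg_T j + (ang (ext x j / ext x k))%:A)].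
Proof.
move: {2}(m.-1 - k)%N (erefl (m.-1 - k)%N) => d; elim: d k => [|d IH] k dk kmn.
  exists [::]; split=> //.
    by move=> i; rewrite perm1; repeat case: ifP; lia.
  by move=> x; rewrite alg_phi0_nil big_geq //; lia.
have [//||ks [sz wp ph]] := IH k.+1; [by lia | by lia |].
have kn : (k < n.-1)%N by lia.
exists (Ordinal kn :: ks); split; first by rewrite /= sz; lia.
  move=> i; rewrite word_perm_cons permM simple_reflE /= wp.
  by repeat case: ifP; lia.
move=> x; rewrite alg_phi0_cons ph [RHS]big_ltn; last by lia.
congr (_ * _).
  by rewrite /alg_phi -!ext_val /= insubT.
apply: eq_big_nat => j jm; rewrite !/(ext _ _).
have jn : (j < n)%N by lia.
have kn1 : (k.+1 < n)%N by lia.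
have kn0 : (k < n)%N by lia.
rewrite !insubT /=; congr (_ + (ang (x _ / x _))%:A); apply/val_inj;
  by rewrite /= simple_reflE /=; repeat case: ifP; lia.
Qed.

Lemma card_pairs : #|[set b : 'I_n * 'I_n | (b.1 < b.2)%N]| = 'C(n, 2).
Proof.
rewrite -bin2_sum big_mkord -sum1_card.
under eq_bigl do rewrite inE.
transitivity (\sum_(i < n) \sum_(j < n | (i < j)%N) 1)%N; first by rewrite pair_big_dep.
rewrite (exchange_big_dep xpredT) //=; apply: eq_bigr => j _.
by rewrite -(big_ord_widen n (fun=> 1%N)) ?sum1_card ?card_ord // ltnW.
Qed.

(** The word (0 .. m-2)(0 .. m-3) .. (0) reverses the first m positions.  Its first part
    contributes the factors of the pairs (0, j), and shifts the coordinates for the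
    rest. *)
Lemma tri_word m : (m <= n)%N -> exists ks : seq 'I_n.-1,
  [/\ size ks = 'C(m, 2),
      forall i, word_perm ks i = (if (i < m)%N then (m.-1 - i)%N else i) :> nat
    & forall x, alg_phi0 ks x =
        \prod_(0 <= i < m) \prod_(i.+1 <= j < m) pair_factor x i j].
Proof.
elim: m => [|m IH] mn.
  exists [::]; split=> // [i|x]; first by rewrite perm1.
  by rewrite alg_phi0_nil big_geq.
have [ks [sz wp ph]] := IH (ltnW mn).
have [//|ks0 [sz0 wp0 ph0]] := @row_word 0 m.+1.
exists (ks0 ++ ks); split.
- by rewrite size_cat sz sz0 subn0 binS bin1 addnC.
- move=> i; rewrite word_perm_cat permM wp0 wp /=.
  by repeat case: ifP; lia.
move=> x; rewrite alg_phi0_cat ph0 ph [RHS]big_nat_recl //; congr (_ * _).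
  by apply: eq_big_nat => j _; rewrite /pair_factor subn0.
apply: eq_big_nat => i im; rewrite [RHS]big_add1 /=.
apply: eq_big_nat => j jm; rewrite /pair_factor subSS.
have e k : (k < m)%N -> ext (fun i0 => x (word_perm ks0 i0)) k = ext x k.+1.
  move=> km; have kn : (k < n)%N by lia.
  rewrite -[k]/(val (Ordinal kn)) ext_val -ext_val wp0 /=.
  by rewrite km.
by rewrite (e i) ?(e j) //; lia.
Qed.

(** The permutation of [tri_word] inverts all pairs, so that the longest element, whose
    number of inversions is maximal, inverts all pairs as well and equals it. *)
Lemma alg_phi0_longest w0 ks x : longest_element w0 -> reduced_decomposition w0 ks ->
  generic x ->
  alg_phi0 ks x = \prod_(0 <= i < n) \prod_(i.+1 <= j < n) pair_factor x i j.
Proof.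
move=> long red gx; have [kt [szt wpt <-]] := tri_word (leqnn n).
set r := word_perm kt in wpt.
have nr : inversions r^-1%g = 'C(n, 2).
  rewrite -card_pairs; apply: eq_card => -[i j]; rewrite !inE /=.
  case: ltnP => //= ij; apply: contraTT ij; rewrite -!leqNgt.
  have := wpt (r^-1%g i); have := wpt (r^-1%g j); rewrite !permKV !ltn_ord.
  have := ltn_ord (r^-1%g i); have := ltn_ord (r^-1%g j); lia.
have redt : reduced_decomposition r kt.
  split=> // ks' e; rewrite szt -nr -e -word_invE; exact: inversions_le_size.
have le := long _ _ _ redt red; have szk := reduced_size red.
have e : word_inv ks = word_inv kt; last first.
  have sz : size ks = size kt.
    apply/eqP; rewrite eqn_leq le andbT szt szk -card_pairs.
    by apply: subset_leq_card; apply/subsetP => b; rewrite !inE => /andP[].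
  apply: (alg_phi0_reduced gx (erefl (size ks))) => //.
  by rewrite word_invE szk; case: red => ->.
rewrite !word_invE -/r; case: (red) => -> _.
have eD : [set b : 'I_n * 'I_n | (b.1 < b.2)%N & (w0^-1%g b.2 < w0^-1%g b.1)%N] =
    [set b : 'I_n * 'I_n | (b.1 < b.2)%N].
  apply/eqP; rewrite eqEcard; apply/andP; split.
    by apply/subsetP => b; rewrite !inE => /andP[].
  by rewrite card_pairs -szt -[X in (_ <= X)%N]/(inversions _) -szk.
(* [r] reverses the order and the inverse of [w0] reverses it too, so that their product
   is increasing. *)
apply: (mulgI r); rewrite mulgV; apply: no_descent => k; rewrite !permM.
have : (r (gen_hi k), r (gen_lo k)) \in [set b : 'I_n * 'I_n | (b.1 < b.2)%N].
  by rewrite inE /= !wpt !ltn_ord /=; have := ltn_ord k; lia.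
by rewrite -eD inE => /andP[].
Qed.

End Matsumoto.

(** * Partial products that are eigenvectors of a generator *)

Section Eigen.
Variables (K : fieldType) (q : K) (n : nat) (A : algType K) (t : 'I_n.-1 -> A).
Local Notation ang := (angle q).
Hypothesis braidT : forall k l : 'I_n.-1, l = k.+1 :> nat -> t k * t l * t k = t l * t k * t l.
Hypothesis commT : forall k l : 'I_n.-1, (k.+1 < l)%N || (l.+1 < k)%N -> t k * t l = t l * t k.
Hypothesis quadT : forall k, (t k - q%:A) * (t k + 1) = 0.
Local Notation T := (alg_T t).

Lemma alg_T_comm i j : (i.+1 < j)%N || (j.+1 < i)%N -> T i * T j = T j * T i.
Proof.
case: i j => [|i] [|j]; rewrite /alg_T ?mul0r ?mulr0 //= => ij.
by case: insubP => [k _ ek|_]; case: insubP => [l _ el|_];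
  rewrite /= ?mul0r ?mulr0 //; apply: commT; rewrite ek el.
Qed.

(** Both sides are 0 when one of the indices is out of range. *)
Lemma alg_T_braid i : T i * T i.+1 * T i = T i.+1 * T i * T i.+1.
Proof.
case: i => [|i]; rewrite /alg_T ?(mul0r, mulr0) //=.
by case: insubP => [k _ ek|_]; case: insubP => [l _ el|_];
  rewrite /= ?(mul0r, mulr0) //; apply: braidT; rewrite ek el.
Qed.

Lemma alg_T_sqr i : (0 < i < n)%N -> T i * T i = (q - 1) *: T i + q%:A.
Proof.
case: i => // i /= iln; rewrite /alg_T.
have il : (i < n.-1)%N by lia.
by rewrite insubT /= (gen_sqr quadT).
Qed.

Variables (x : 'I_n -> K).
Hypothesis gx : generic x.
Local Notation y := (ext x).
Local Notation F := (pair_factor q t x).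

Lemma ext_neq0 i : y i != 0.
Proof. by rewrite /ext; case: insubP => [j _ _|_] /=; rewrite ?oner_eq0 ?(proj2 gx). Qed.

Lemma ext_neq1 i j : (i < n)%N -> (j < n)%N -> i != j -> y j / y i != 1.
Proof.
move=> lin ljn ij; rewrite -[i]/(val (Ordinal lin)) -[j]/(val (Ordinal ljn)) !ext_val.
by apply: generic_neq1 => //; rewrite -val_eqE /= eq_sym.
Qed.

Lemma gen_factor_comm k i j : (k.+1 < j - i)%N || ((j - i).+1 < k)%N ->
  GRing.comm (T k) (F i j).
Proof.
move=> kij; apply: commrD; first exact: alg_T_comm.
by rewrite /GRing.comm mulr_algl mulr_algr.
Qed.

(** The indices of the two generators satisfy j - i >= (j' - i') + 2. *)
Lemma factor_comm i j i' j' : (i < i')%N -> (i' < j')%N -> (j' < j)%N ->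
  F i j * F i' j' = F i' j' * F i j.
Proof.
move=> ii ij jj; apply/commrD; last by rewrite /GRing.comm mulr_algl mulr_algr.
by apply/esym/gen_factor_comm; lia.
Qed.

Lemma big_nat_cond_split (P : nat -> bool) (G : nat -> A) a b c :
  (a <= b)%N -> (b < c)%N -> P b ->
  \prod_(a <= i < c | P i) G i =
  \prod_(a <= i < b | P i) G i * (G b * \prod_(b.+1 <= i < c | P i) G i).
Proof.
move=> ab bc Pb; rewrite (big_cat_nat (n := b)) ?(ltnW bc) //=.
by rewrite [X in _ * X]big_ltn_cond // Pb.
Qed.

Lemma comm_prod_nat k (P : nat -> bool) (G : nat -> A) a b :
  (forall i, (a <= i < b)%N -> P i -> GRing.comm (T k) (G i)) ->
  GRing.comm (T k) (\prod_(a <= i < b | P i) G i).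
Proof.
move=> H; rewrite big_seq_cond; apply: comm_prod => i /andP[].
by rewrite mem_index_iota; apply: H.
Qed.

Hypothesis q1 : q != 1.

Lemma row_pair_factor i : (i.+1 < n)%N -> y i.+1 = q * y i ->
  F i i.+1 = T 1 + 1.
Proof.
by move=> i1 e; rewrite /pair_factor subSnn e mulfK ?ext_neq0 // angle_q // scale1r.
Qed.

(** The predicate [P] selects the pairs of a partial product in lexicographic order; the
    hypotheses describe the pairs that follow (i, j) in the blocks of column l, where l is
    the row of j.  The factor T_1 + 1 of (j-1, j) is moved to the left: past the factors
    of row i' the eigenvalue relation passes from T_(j-i'-1) to T_(j-i') by
    [eigen_absorb_right], applied to the factors of (i', j-1) and (i', j). *)
Lemma right_eigen (P : nat -> nat -> bool) i j :
  (i.+1 < j < n)%N -> y j = q * y j.-1 ->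
  (forall i' j', P i' j' -> i' < j')%N ->
  (forall i' j', P i' j' -> i <= i')%N ->
  (forall j', P i j' -> j < j')%N ->
  (forall i', i < i' < j.-1 -> P i' j.-1)%N ->
  (forall i', i < i' < j -> P i' j)%N ->
  let R := \prod_(0 <= i' < n) \prod_(0 <= j' < n | P i' j') F i' j' in
  T (j - i - 1)%N * R = q *: R.
Proof.
move=> ijn yj Plt Pge Pi Pj1 Pj /=.
pose row i' := \prod_(0 <= j' < n | P i' j') F i' j'.
have tail m : (i < m <= j.-1)%N ->
    T (j - m)%N * \prod_(m <= i' < n) row i' = q *: \prod_(m <= i' < n) row i'.
  move: {2}(j.-1 - m)%N (erefl (j.-1 - m)%N) => d; elim: d m => [|d IH] m dm im.
    have -> : m = j.-1 by lia.
    have -> : (j - j.-1 = 1)%N by lia.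
    rewrite big_ltn; last by lia.
    rewrite /row (@big_nat_cond_split _ _ 0 j) //; [|lia|by apply: Pj; lia].
    have -> : \prod_(0 <= j' < j | P j.-1 j') F j.-1 j' = 1.
      rewrite big_nat_cond big1 // => j' /andP[/andP[_ jj]] /Plt; lia.
    rewrite mul1r.
    have := @row_pair_factor j.-1; have -> : j.-1.+1 = j by lia.
    move=> -> //; last by lia.
    rewrite !mulrA !scalerAl; congr (_ * _ * _).
    rewrite mulrDr mulr1 alg_T_sqr; last by lia.
    by rewrite addrAC -{2}[T 1]scale1r -scalerDl subrK scalerDr.
  rewrite big_ltn; last by lia.
  rewrite /row (@big_nat_cond_split _ _ 0 j.-1) //; [|lia|by apply: Pj1; lia].
  have -> : j.-1.+1 = j by lia.
  rewrite (@big_nat_cond_split _ _ j j) //; [|lia|by apply: Pj; lia].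
  rewrite (@big_geq _ _ _ j j) // mul1r -/row.
  set L := \prod_(0 <= j' < j.-1 | _) _; set Rt := \prod_(j.+1 <= j' < n | _) _.
  set tl := \prod_(m.+1 <= i' < n) _.
  have cL : T (j - m)%N * L = L * T (j - m)%N.
    by apply: comm_prod_nat => j' jj /Plt mj; apply: gen_factor_comm; lia.
  rewrite -(mulrA L) mulrA cL -mulrA scalerAr; congr (_ * _).
  rewrite (mulrA (F m j.-1)) -(mulrA _ Rt) /pair_factor.
  have -> : (j - m = (j.-1 - m).+1)%N by lia.
  apply: eigen_absorb_right; first exact: alg_T_braid.
  - by apply: alg_T_sqr; lia.
  - have e : y j / y m = q * (y j.-1 / y m) by rewrite yj mulrA.
    rewrite e; apply: angle_qM; first by apply: ext_neq1; lia.
    by rewrite -e; apply: ext_neq1; lia.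
  rewrite mulrA [T _ * Rt]comm_prod_nat; last first.
    by move=> j' jj /Plt mj; apply: gen_factor_comm; lia.
  have := IH m.+1; rewrite -/tl.
  have -> : (j - m.+1 = j.-1 - m)%N by lia.
  by move=> IHm; rewrite -mulrA IHm -?scalerAr //; lia.
rewrite (@big_cat_nat _ _ _ i) /=; [|lia|lia].
rewrite big_nat big1 ?mul1r; last first.
  by move=> i' /andP[_ ii]; rewrite big1 // => j' /Pge; lia.
rewrite big_ltn; last by lia.
have -> : (j - i - 1 = j - i.+1)%N by lia.
rewrite mulrA [T _ * _]comm_prod_nat; last first.
  by move=> j' jj /Pi mj; apply: gen_factor_comm; lia.
by rewrite -mulrA -/row tail ?scalerAr //; lia.
Qed.

(** The mirror image of [right_eigen]: [P] describes the pairs that precede (i, j), in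
    colexicographic order, and the factor T_1 + 1 of (i, i+1) is moved to the right
    through the columns i+2, .., j-1. *)
Lemma left_eigen (P : nat -> nat -> bool) i j :
  (i.+1 < j < n)%N -> y i.+1 = q * y i ->
  (forall i' j', P i' j' -> i' < j')%N ->
  (forall i' j', j <= j' -> P i' j' -> i' < i)%N ->
  (forall j', i < j' < j -> P i j')%N ->
  (forall j', i.+1 < j' < j -> P i.+1 j')%N ->
  let L := \prod_(0 <= j' < n) \prod_(0 <= i' < n | P i' j') F i' j' in
  L * T (j - i - 1)%N = q *: L.
Proof.
move=> ijn yi Plt Pge Pi Pi1 /=.
pose col j' := \prod_(0 <= i' < n | P i' j') F i' j'.
have head m : (i.+1 < m <= j)%N ->
    \prod_(0 <= j' < m) col j' * T (m - i - 1)%N = q *: \prod_(0 <= j' < m) col j'.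
  elim: m => // m IH im.
  rewrite big_nat_recr //=.
  (* The first nontrivial column is i+1, and its last factor is that of (i, i+1). *)
  have [mi|mi] := eqVneq m i.+1.
    rewrite {2 4}/col (@big_nat_cond_split _ _ 0 i) //; [|lia|by apply: Pi; lia].
    have -> : \prod_(i.+1 <= i' < n | P i' m) F i' m = 1.
      rewrite big_nat_cond big1 // => i' /andP[/andP[ii _]] /Plt; lia.
    rewrite mulr1.
    rewrite mi; have -> : (i.+2 - i - 1 = 1)%N by lia.
    rewrite row_pair_factor //; last by lia.
    rewrite !mulrA -(mulrA _ (T 1 + 1)) scalerAr; congr (_ * _).
    rewrite mulrDl mul1r alg_T_sqr; last by lia.
    by rewrite addrAC -{2}[T 1]scale1r -scalerDl subrK scalerDr.
  rewrite {2 4}/col (@big_nat_cond_split _ _ 0 i) //; [|lia|by apply: Pi; lia].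
  rewrite (@big_nat_cond_split _ _ i.+1 i.+1) //; [|lia|by apply: Pi1; lia].
  rewrite (@big_geq _ _ _ i.+1 i.+1) // mul1r.
  set L := \prod_(0 <= i' < i | _) _; set Rt := \prod_(i.+2 <= i' < n | _) _.
  set hd := \prod_(0 <= j' < m) _.
  have cR : GRing.comm (T (m.+1 - i - 1)%N) Rt.
    by apply: comm_prod_nat => i' ii /Plt mj; apply: gen_factor_comm; lia.
  rewrite [F i m * _]mulrA (mulrA L) (mulrA hd) -(mulrA _ Rt) -cR mulrA scalerAl.
  congr (_ * _); rewrite (mulrA hd) /pair_factor.
  have -> : (m.+1 - i - 1 = (m - i.+1).+1)%N by lia.
  have -> : (m - i = (m - i.+1).+1)%N by lia.
  apply: eigen_absorb_left; first exact: alg_T_braid.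
  - by apply: alg_T_sqr; lia.
  - have e : y m / y i = q * (y m / y i.+1).
      have := ext_neq0 i.+1; rewrite yi mulf_eq0 negb_or => /andP[q0 y0].
      by rewrite invfM (mulrCA (y m)) mulVKf.
    rewrite e; apply: angle_qM; first by apply: ext_neq1; lia.
    by rewrite -e; apply: ext_neq1; lia.
  rewrite -mulrA -[L * T _]comm_prod_nat; last first.
    by move=> i' ii Pm; apply: gen_factor_comm; lia.
  rewrite mulrA; have -> : (m - i.+1 = m - i - 1)%N by lia.
  by rewrite IH ?scalerAl //; lia.
rewrite (@big_cat_nat _ _ _ j) /=; [|lia|lia].
rewrite -mulrA -[_ * T _]comm_prod_nat; last first.
  move=> j' jj _; apply: comm_prod_nat => i' ii Pij; apply: gen_factor_comm.
  by have := Pge _ _ _ Pij; lia.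
by rewrite mulrA head ?scalerAl //; lia.
Qed.

End Eigen.

(** * Cherednik diagrams and the special order *)

Section Diagram.
Variable lam : diagram.
Hypothesis cher : cherednik lam.
Local Notation n := (degree lam).
Local Notation a := (row_start lam).
Local Notation b := (row_end lam).

(** The step from one box to the next in the row filling: either to the right or from the
    end of a row to the beginning of the next one. *)
Definition next_box (u v : nat * int) : bool :=
  ((v.1 == u.1) && (v.2 == u.2 + 1)) ||
  [&& v.1 == u.1.+1, u.2 == b u.1 & v.2 == a v.1].

Definition row_boxes i : seq (nat * int) :=
  [seq (i, a i + j%:Z) | j <- iota 0 (row_size (a i, b i))].

Lemma row_boxesP i : (1 <= i <= size lam)%N -> exists p,
  [/\ row_boxes i = (i, a i) :: p, path next_box (i, a i) p & last (i, a i) p = (i, b i)].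
Proof.
move=> /(proj1 cher) ab.
have [d dE] : exists d : nat, b i = a i + d%:Z.
  by exists (absz (b i - a i)); lia.
rewrite /row_boxes /row_size /=.
have -> : absz (b i - a i + 1) = d.+1 by rewrite dE; lia.
exists [seq (i, a i + j%:Z) | j <- iota 1 d]; rewrite dE; split.
- by rewrite /= addr0.
- have : forall s, path next_box (i, a i + s%:Z) [seq (i, a i + j%:Z) | j <- iota s.+1 d].
    elim: d {dE} => //= d IH s; rewrite IH andbT /next_box /= eqxx.
    by rewrite (_ : a i + s.+1%:Z == a i + s%:Z + 1) //; apply/eqP; lia.
  by move/(_ 0%N); rewrite addr0.
- have -> : (i, a i) = (i, a i + 0%N%:Z) by rewrite addr0.
  rewrite (last_map (fun j : nat => (i, a i + j%:Z))).
  have li m k : last k (iota k.+1 m) = (k + m)%N.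
    by elim: m k => [|m IH] k /=; rewrite ?addn0 // IH addSnnS.
  by rewrite li.
Qed.

Lemma rows_boxesP m s : (1 <= s)%N -> (s + m <= size lam)%N -> exists p,
  [/\ flatten [seq row_boxes i | i <- iota s m.+1] = (s, a s) :: p,
      path next_box (s, a s) p & last (s, a s) p = ((s + m)%N, b (s + m)%N)].
Proof.
elim: m s => [|m IH] s s1 sm.
  have [|p [e pp lp]] := @row_boxesP s; first by lia.
  by exists p; rewrite /= cats0 addn0.
have [//||p [e pp lp]] := IH s.+1; first by lia.
have [|p0 [e0 pp0 lp0]] := @row_boxesP s; first by lia.
exists (p0 ++ (s.+1, a s.+1) :: p).
split.
- by rewrite -[iota s _]/(s :: iota s.+1 m.+1) map_cons -cat1s flatten_cat e /= e0 cats0.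
- by rewrite cat_path pp0 /= pp andbT /next_box lp0 /= !eqxx orbT.
- by rewrite last_cat /= lp addSnnS.
Qed.

Lemma boxesP : (0 < n)%N -> exists p,
  [/\ boxes lam = (1%N, a 1%N) :: p, path next_box (1%N, a 1%N) p
    & last (1%N, a 1%N) p = (size lam, b (size lam))].
Proof.
move=> n0; have s0 : (0 < size lam)%N.
  by move: n0; rewrite /degree; case: (lam) => //; rewrite big_nil.
have [//||p [e pp lp]] := @rows_boxesP (size lam).-1 1; first by lia.
exists p; rewrite /boxes -e lp add1n prednK //.
Qed.

Lemma box_of_range (k : 'I_n) : let r := row_of k in
  (1 <= r <= size lam)%N /\ (a r <= (box_of k).2 <= b r)%R.
Proof.
have : box_of k \in boxes lam by rewrite mem_nth // size_boxes.
rewrite /row_of => /flattenP[s /mapP[i]]; rewrite mem_iota => ri -> /mapP[j].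
rewrite mem_iota /row_size /= => jr ->; split=> /=; first by lia.
have := proj1 cher i; have -> : (1 <= i <= size lam)%N by lia.
move=> /(_ isT) /=; lia.
Qed.

Lemma row_of_range (k : 'I_n) : (1 <= row_of k <= size lam)%N.
Proof. by case: (box_of_range k). Qed.

(** The contents of the first and the last box of a row. *)
Definition first_content r : int := a r - r%:Z.
Definition last_content r : int := b r - r%:Z.

Lemma content_range (k : 'I_n) :
  (first_content (row_of k) <= content k <= last_content (row_of k))%R.
Proof. case: (box_of_range k); rewrite /first_content /last_content /content /row_of; lia. Qed.

Lemma next_boxP (k k' : 'I_n) : k' = k.+1 :> nat ->
  row_of k' = row_of k /\ content k' = content k + 1 \/
  [/\ row_of k' = (row_of k).+1, content k = last_content (row_of k) &
     content k' = first_content (row_of k')].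
Proof.
move=> kk; have [|p [e pp lp]] := boxesP; first by have := ltn_ord k; lia.
have /(_ k) : forall i, (i < size p)%N ->
    next_box (nth (0%N, 0) (boxes lam) i) (nth (0%N, 0) (boxes lam) i.+1).
  by move=> i ip; rewrite e /=; apply: (pathP (0%N, 0)).
have sp : size p = n.-1 by rewrite -(size_boxes lam) e.
have -> : (k < size p)%N by have := ltn_ord k'; lia.
rewrite -[nth _ _ k]/(box_of k) -kk -[nth _ _ k']/(box_of k') => /(_ isT).
rewrite /next_box /content /row_of /first_content /last_content.
move: (box_of k) (box_of k') => [r c] [r' c'] /=.
case/orP=> [/andP[/eqP-> /eqP->]|/and3P[/eqP-> /eqP-> /eqP->]]; last by right.
by left; split=> //; rewrite addrAC.
Qed.

Lemma first_number_content (k : 'I_n) : k = 0%N :> nat -> content k = first_content (row_of k).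
Proof.
move=> k0; have [|p [e pp lp]] := boxesP; first by have := ltn_ord k; lia.
by rewrite /content /first_content /row_of /box_of k0 e.
Qed.

Lemma last_number_content (k : 'I_n) : k.+1 = n -> content k = last_content (row_of k).
Proof.
move=> k0; have [|p [e pp lp]] := boxesP; first by have := ltn_ord k; lia.
have sp : size p = k by apply: succn_inj; rewrite k0 -[in RHS](size_boxes lam) e.
rewrite /content /last_content /row_of /box_of -sp e.
pose bs := (1%N, a 1%N) :: p.
by rewrite -[nth _ _ _]/(nth (0%N, 0) bs (size bs).-1) nth_last /= lp.
Qed.

Lemma row_of_mono (i j : 'I_n) : (i <= j)%N -> (row_of i <= row_of j)%N.
Proof.
move: {2}(j - i)%N (erefl (j - i)%N) => d; elim: d j => [|d IH] j dj ij.
  by have -> : i = j by apply: val_inj => /=; lia.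
have j1 : (j.-1 < n)%N by have := ltn_ord j; lia.
have := IH (Ordinal j1) _ _; rewrite /= => le.
apply: leq_trans (le _ _) _; try lia.
by have := @next_boxP (Ordinal j1) j; rewrite /= => /(_ ltac:(lia)) [[-> _]|[-> _ _]].
Qed.

Lemma row_of_lt (i j : 'I_n) : (row_of i < row_of j)%N -> (i < j)%N.
Proof. by apply: contraLR; rewrite -!leqNgt; apply: row_of_mono. Qed.

Lemma content_same_row (i j : 'I_n) : (i <= j)%N -> row_of i = row_of j ->
  content j = content i + (j - i)%N%:Z.
Proof.
move: {2}(j - i)%N (erefl (j - i)%N) => d; elim: d j => [|d IH] j dj ij.
  by have -> : i = j by [apply: val_inj => /=; lia]; rewrite subnn addr0.
have j1 : (j.-1 < n)%N by have := ltn_ord j; lia.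
move=> e; have ij1 : (i <= j.-1)%N by lia.
have m1 := @row_of_mono i (Ordinal j1) ij1.
have m2 : (row_of (Ordinal j1) <= row_of j)%N by apply: row_of_mono => /=; lia.
have := IH (Ordinal j1) _ _ _; rewrite /= => le.
have := @next_boxP (Ordinal j1) j; rewrite /= => /(_ ltac:(lia)) [[er ->]|[er _ _]]; last by lia.
rewrite le; lia.
Qed.

Lemma pred_in_row (j : 'I_n) : (first_content (row_of j) < content j)%R ->
  exists2 j' : 'I_n, j'.+1 = j & row_of j' = row_of j.
Proof.
move=> lt; have j0 : (0 < j)%N.
  by rewrite lt0n; apply/eqP => /first_number_content e; rewrite e Order.POrderTheory.ltxx in lt.
have j1 : (j.-1 < n)%N by have := ltn_ord j; lia.
exists (Ordinal j1) => /=; first by lia.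
have := @next_boxP (Ordinal j1) j; rewrite /= => /(_ ltac:(lia)) [[-> _]//|[_ _ e]].
by rewrite e Order.POrderTheory.ltxx in lt.
Qed.

Lemma succ_in_row (i : 'I_n) : (content i < last_content (row_of i))%R ->
  exists2 i' : 'I_n, i' = i.+1 :> nat & row_of i' = row_of i.
Proof.
move=> lt; have i1 : (i.+1 < n)%N.
  rewrite ltn_neqAle ltn_ord andbT; apply/eqP => /last_number_content e.
  by rewrite e Order.POrderTheory.ltxx in lt.
exists (Ordinal i1) => //.
have [//||[_ e _]] := @next_boxP i (Ordinal i1); first by case.
by rewrite e Order.POrderTheory.ltxx in lt.
Qed.

(** This is the Cherednik condition read on contents: from one row to the next the last
    content decreases, or it stays the same and then the first content does not
    increase. *)
Lemma end_contents_mono k l : (1 <= k <= l)%N -> (l <= size lam)%N ->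
  (last_content l <= last_content k)%R /\
  (last_content l = last_content k -> (first_content l <= first_content k)%R).
Proof.
move=> /andP[k1 kl]; elim: l kl => [|l IH] kl ls; first by lia.
have [ekl|nkl] := eqVneq k l.+1; first by subst k; split.
have [||h1 h2] := IH; [by lia | by lia |].
have := proj2 cher l; have -> : (1 <= l < size lam)%N by lia.
move=> /(_ isT); move: h1 h2; rewrite /last_content /first_content; lia.
Qed.

Lemma last_content_between k l m : (1 <= k <= l)%N -> (l <= m)%N -> (m <= size lam)%N ->
  last_content k = last_content m -> last_content l = last_content m.
Proof.
move=> kl lm ms e.
have [|h1 _] := @end_contents_mono k l kl; first by lia.
have [||h2 _] := @end_contents_mono l m; first by lia.
  by lia.
lia.
Qed.

Lemma e_minusE (c : 'I_n * 'I_n) :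
  e_minus c = (last_content (row_of c.1) == last_content (row_of c.2)).
Proof. by []. Qed.

Lemma head_content (k : 'I_n) : is_row_head k = (content k == first_content (row_of k)).
Proof. by rewrite /is_row_head /content /first_content /row_of (inj_eq (addIr _)). Qed.

Implicit Type c : 'I_n * 'I_n.

(** Contents increase along a row, so numbers with equal contents are in different
    rows. *)
Lemma singular_rows c : singular c -> (row_of c.1 < row_of c.2)%N.
Proof.
case: c => i j /andP[/= ij /eqP ec]; rewrite ltn_neqAle row_of_mono ?(ltnW ij) // andbT.
apply/eqP => e; have := content_same_row (ltnW ij) e; rewrite /inP /= in ij *; lia.
Qed.

Lemma parallel_heads_singular c : parallel_heads c -> singular c.
Proof.
case: c => i j /and4P[/= ij hdi hdj /andP[/eqP p1 _]]; rewrite /singular /inP /= ij /=.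
by move: hdi hdj; rewrite !head_content /first_content => /eqP -> /eqP ->; apply/eqP.
Qed.

(** If j were the head of its row l, its content would be the first content of row l.
    As rows k and l have the same last content, [end_contents_mono] forces their first
    contents to agree, so the two rows would be parallel with heads i and j. *)
Lemma minus_pair c : inR c -> e_minus c -> exists c', is_minus c c'.
Proof.
case: c => i j /andP[sc nh] em; have /= rij := singular_rows sc.
have /= ec : content i = content j by case/andP: sc => _ /eqP.
have ij : (i < j)%N by case/andP: sc.
move: em; rewrite e_minusE /= => /eqP em.
have [rj1 rj2] := andP (row_of_range j); have [ri1 ri2] := andP (row_of_range i).
have [||_ /(_ (esym em)) lol] := @end_contents_mono (row_of i) (row_of j); [by lia | by lia |].
have [|j' e1 e2] := @pred_in_row j.
  have := content_range i; have := content_range j => cj ci.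
  rewrite Order.POrderTheory.lt_neqAle; apply/andP; split; last by lia.
  apply: contra nh => /eqP ej; rewrite /parallel_heads /= ij !head_content.
  have -> : content i == first_content (row_of i) by lia.
  have -> : content j == first_content (row_of j) by lia.
  have el : first_content (row_of i) = first_content (row_of j) by lia.
  rewrite /=; apply/andP; split; apply/eqP; [exact: el | exact: em].
by exists (i, j'); rewrite /is_minus /= eqxx e1 e2 !eqxx.
Qed.

(** If i were the end of its row k, its content would be the last content of row k, which
    is strictly larger than all contents of row l. *)
Lemma plus_pair c : singular c -> ~~ e_minus c -> exists c', is_plus c c'.
Proof.
case: c => i j sc; have /= rij := singular_rows sc.
have /= ec : content i = content j by case/andP: sc => _ /eqP.
rewrite e_minusE /= => em.
have [rj1 rj2] := andP (row_of_range j); have [ri1 ri2] := andP (row_of_range i).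
have [||hh _] := @end_contents_mono (row_of i) (row_of j); [by lia | by lia |].
have := content_range i; have := content_range j => cj ci.
have [|i' e1 e2] := @succ_in_row i; first by lia.
by exists (i', j); rewrite /is_plus /= e1 e2 !eqxx.
Qed.

(** A lexicographic form of the special order: by row of the second number, then by row
    of the first one, then inside the block. *)
Lemma special_ltE (c d : 'I_n * 'I_n) : special_lt c d =
  (row_of c.2 < row_of d.2)%N || (row_of c.2 == row_of d.2) &&
   ((row_of c.1 < row_of d.1)%N || (row_of c.1 == row_of d.1) &&
     (if last_content (row_of c.1) == last_content (row_of c.2) then lt1 c d else lt2 c d)).
Proof.
rewrite /special_lt e_minusE xpair_eqE.
by do 2!case: ltngtP => //=; rewrite ?andbF.
Qed.

Lemma special_lt_row c d : special_lt c d -> (row_of c.2 <= row_of d.2)%N.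
Proof. by rewrite special_ltE => /orP[/ltnW//|/andP[/eqP-> _]]. Qed.

Lemma special_lt_trans : transitive (@special_lt lam).
Proof.
move=> d c e; rewrite !special_ltE /lt1 /lt2 -!val_eqE /=.
have [e1|] := eqVneq (row_of c.1) (row_of d.1);
have [e2|] := eqVneq (row_of c.2) (row_of d.2); rewrite ?e1 ?e2; repeat case: ifP; lia.
Qed.

Lemma special_lt_irr : irreflexive (@special_lt lam).
Proof. by move=> c; rewrite special_ltE /lt1 /lt2 !ltnn; case: ifP; rewrite !andbF. Qed.

Lemma special_lt_total (c d : 'I_n * 'I_n) : c != d -> special_lt c d || special_lt d c.
Proof.
case: c d => [i j] [i' j']; rewrite xpair_eqE !special_ltE /lt1 /lt2 -!val_eqE /=.
have [e1|] := eqVneq (row_of i) (row_of i');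
have [e2|] := eqVneq (row_of j) (row_of j'); rewrite ?e1 ?e2; repeat case: ifP; lia.
Qed.

(** The special order is compatible with the product order on pairs. *)
Lemma special_lt_below (c d : 'I_n * 'I_n) : special_lt c d ->
  ~~ ((d.1 <= c.1) && (d.2 <= c.2))%N.
Proof.
rewrite special_ltE /lt1 /lt2 -!val_eqE /=; apply: contraL => /andP[h1 h2].
have := row_of_mono h1; have := row_of_mono h2; case: ifP; lia.
Qed.

Lemma mem_special_seq c : (c \in special_seq lam) = inP c.
Proof. by rewrite mem_sort mem_filter mem_enum andbT. Qed.

Lemma special_seq_uniq : uniq (special_seq lam).
Proof. by rewrite sort_uniq filter_uniq ?enum_uniq. Qed.

Lemma special_seq_pairwise : pairwise (@special_lt lam) (special_seq lam).
Proof.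
pose leS (c d : 'I_n * 'I_n) := (c == d) || special_lt c d.
have leS_trans : transitive leS.
  move=> d c e /orP[/eqP->//|cd] /orP[/eqP<-|de]; first by rewrite /leS cd orbT.
  by rewrite /leS (special_lt_trans cd de) orbT.
have : sorted leS (special_seq lam).
  apply: sort_sorted => c d; rewrite /leS [d == c]eq_sym; case: eqVneq => //=.
  exact: special_lt_total.
rewrite (sorted_pairwise leS_trans) => ps.
have := special_seq_uniq; rewrite uniq_pairwise => us.
have : pairwise [rel c d | leS c d && (c != d)] (special_seq lam).
  by rewrite pairwise_relI ps us.
apply: sub_pairwise => c d /= /andP[]; rewrite /leS; case: eqVneq => //.
Qed.

Lemma special_seq_split s1 s2 c d : special_seq lam = s1 ++ c :: s2 -> inP d ->
  (d \in s1 = special_lt d c) /\ (d \in s2 = special_lt c d).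
Proof.
move=> e Pd; have := special_seq_pairwise; rewrite e pairwise_cat /=.
move=> /and4P[/allrelP h1 _ /allP h2 _].
have : d \in s1 ++ c :: s2 by rewrite -e mem_special_seq.
have asym (u v : 'I_n * 'I_n) : special_lt u v -> special_lt v u = false.
  by move=> uv; apply/negP => /(special_lt_trans uv); rewrite special_lt_irr.
have i1 : d \in s1 -> special_lt d c by move=> ds; apply: h1 => //; apply: mem_head.
rewrite mem_cat inE => /or3P[ds|/eqP ->|ds].
- rewrite ds (i1 ds) (asym _ _ (i1 ds)); split=> //; apply/negP => /h2.
  by rewrite (asym _ _ (i1 ds)).
- rewrite special_lt_irr; split; apply/negP; last by move/h2; rewrite special_lt_irr.
  by move/(h1 c c)/(_ (mem_head _ _)); rewrite special_lt_irr.
- rewrite ds (h2 _ ds) (asym _ _ (h2 _ ds)); split=> //; apply/negP => /i1.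
  by rewrite (asym _ _ (h2 _ ds)).
Qed.

End Diagram.

(** * Fusion of the singular factors *)

Lemma split_prefix (T : Type) (p : pred T) (s : seq T) : exists s1 s2,
  [/\ s = s1 ++ s2, all p s1 & (if s2 is x :: _ then ~~ p x else true)].
Proof.
elim: s => [|x s [s1 [s2 [-> p1 p2]]]]; first by exists [::], [::].
case px : (p x); first by exists (x :: s1), s2; rewrite /= px p1.
by exists [::], (x :: s1 ++ s2); rewrite /= px.
Qed.

Section Scan.
Variable lam : diagram.
Hypothesis cher : cherednik lam.
Local Notation n := (degree lam).
Implicit Types b c d : 'I_n * 'I_n.
Local Notation S := (special_seq lam).

(** The factors of the fused product: a pair that stays alone, or two adjacent pairs
    (xi^-, xi) or (xi, xi^+) that are replaced by a three-term factor. *)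
Variant item :=
  | Single of 'I_n * 'I_n
  | MinusPair of 'I_n * 'I_n & 'I_n * 'I_n
  | PlusPair of 'I_n * 'I_n & 'I_n * 'I_n.

Definition item_code it :
    ('I_n * 'I_n) + (('I_n * 'I_n) * ('I_n * 'I_n)) + (('I_n * 'I_n) * ('I_n * 'I_n)) :=
  match it with
  | Single b => inl (inl b) | MinusPair b b' => inl (inr (b, b')) | PlusPair b b' => inr (b, b')
  end.
Definition item_decode u :=
  match u with
  | inl (inl b) => Single b | inl (inr (b, b')) => MinusPair b b' | inr (b, b') => PlusPair b b'
  end.
Lemma item_codeK : cancel item_code item_decode.
Proof. by case. Qed.
HB.instance Definition _ := Equality.copy item (can_type item_codeK).

(** The left-to-right scan of [fused_factors], recording the pairs and not the values. *)
Fixpoint scan (s : seq ('I_n * 'I_n)) : seq item :=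
  match s with
  | [::] => [::]
  | b :: s1 =>
    match s1 with
    | [::] => [:: Single b]
    | b' :: s2 =>
      if [&& inR b', e_minus b' & is_minus b' b] then MinusPair b b' :: scan s2
      else if [&& inR b, ~~ e_minus b & is_plus b b'] then PlusPair b b' :: scan s2
      else Single b :: scan s1
    end
  end.

Definition item_pairs it :=
  match it with Single b => [:: b] | MinusPair b b' => [:: b; b'] | PlusPair b b' => [:: b; b'] end.

Definition item_head it :=
  match it with Single b => b | MinusPair b _ => b | PlusPair b _ => b end.

(** This holds for every item of the scan of the special sequence ([scan_proper]); the
    essential case is the first one, that no pair of R is left alone. *)
Definition proper_item it :=
  match it with
  | Single b => ~~ inR b
  | MinusPair b b' => [&& inR b', e_minus b' & is_minus b' b]
  | PlusPair b b' => [&& inR b, ~~ e_minus b & is_plus b b']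
  end.

Definition unscan (its : seq item) := flatten (map item_pairs its).

Lemma scan_ind (P : seq ('I_n * 'I_n) -> Prop) :
  P [::] -> (forall b, P [:: b]) ->
  (forall b b' s, P s -> P (b' :: s) -> P [:: b, b' & s]) -> forall s, P s.
Proof.
move=> P0 P1 P2 s; suff [] : P s /\ forall b, P (b :: s) by [].
elim: s => [|b' s [IH1 IH2]]; first by split.
by split=> // b; apply: P2.
Qed.

Lemma unscanK s : unscan (scan s) = s.
Proof.
elim/scan_ind: s => //= b b' s IH1 IH2; rewrite /unscan.
case: ifP => _ /=; first by rewrite -[flatten _]/(unscan (scan s)) IH1.
case: ifP => _ /=; first by rewrite -[flatten _]/(unscan (scan s)) IH1.
by rewrite -[flatten _]/(unscan (scan (b' :: s))) IH2.
Qed.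

Lemma unscan_cat its its' : unscan (its ++ its') = unscan its ++ unscan its'.
Proof. by rewrite /unscan map_cat flatten_cat. Qed.

Lemma minus_rows b b' : is_minus b b' ->
  [/\ row_of b'.1 = row_of b.1, row_of b'.2 = row_of b.2, b'.1 = b.1 & b'.2.+1 = b.2].
Proof. by case/and3P => /eqP -> /eqP -> /eqP ->. Qed.

Lemma plus_rows b b' : is_plus b b' ->
  [/\ row_of b'.1 = row_of b.1, row_of b'.2 = row_of b.2, b'.1 = b.1.+1 :> nat & b'.2 = b.2].
Proof. by case/and3P => /eqP -> /eqP -> /eqP ->. Qed.

Lemma minus_inP b b' : singular b -> is_minus b b' -> inP b'.
Proof.
move=> /(singular_rows cher) + /minus_rows[r1 r2 e1 e2]; rewrite /inP e1 -r2 => r.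
by rewrite ltnNge; apply/negP => /(row_of_mono cher); lia.
Qed.

Lemma plus_inP b b' : singular b -> is_plus b b' -> inP b'.
Proof.
move=> /(singular_rows cher) + /plus_rows[r1 r2 e1 e2]; rewrite /inP e2 -r1 => r.
by rewrite ltnNge; apply/negP => /(row_of_mono cher); lia.
Qed.

(** Hence xi^- is neither in R nor a pair of parallel heads. *)
Lemma minus_not_singular b b' : singular b -> is_minus b b' -> ~~ singular b'.
Proof.
move=> /andP[_ /eqP e] /minus_rows[_ r2 e1 e2]; rewrite /singular negb_and e1 e.
have := content_same_row cher (_ : (b'.2 <= b.2)%N) r2; rewrite -e2 => /(_ (leqnSn _)) ->.
by apply/orP; right; lia.
Qed.

Lemma plus_not_singular b b' : singular b -> is_plus b b' -> ~~ singular b'.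
Proof.
move=> /andP[_ /eqP e] /plus_rows[r1 _ e1 e2]; rewrite /singular negb_and e2 -e.
have := content_same_row cher (_ : (b.1 <= b'.1)%N) (esym r1); rewrite e1 => /(_ (leqnSn _)) ->.
by apply/orP; right; lia.
Qed.

Lemma minus_adjacent s1 b s2 : S = s1 ++ b :: s2 -> inR b -> e_minus b ->
  exists s1' b', s1 = rcons s1' b' /\ is_minus b b'.
Proof.
move=> e Rb mb; have [b' mbb] := minus_pair cher Rb mb.
have sb : singular b by case/andP: Rb.
have [r1 r2 e1 e2] := minus_rows mbb; move: (mb); rewrite e_minusE => hb.
have Pb' := minus_inP sb mbb.
have lt : special_lt b' b.
  by rewrite special_ltE r1 r2 hb !eqxx !ltnn /= /lt1 e1 eqxx -e2 ltnSn orbT.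
have [i1 _] := special_seq_split e Pb'; rewrite lt in i1.
case/splitPr: s1 / i1 e => u v e; exists u, b'; split=> //.
case: v e => [|c v] e; first by rewrite cats1.
have e' : S = u ++ b' :: (c :: v ++ b :: s2) by rewrite e -catA.
have Pc : inP c by rewrite -(mem_special_seq c) e' mem_cat !inE eqxx !orbT.
have [_] := special_seq_split e' Pc; rewrite mem_head => /esym bc.
have [] := special_seq_split e Pc; rewrite mem_cat !inE eqxx !orbT => /esym cb _.
exfalso; move: bc cb; rewrite !special_ltE r1 r2 hb /lt1 /lt2 -!val_eqE /= e1 -e2.
have [ec1|] := eqVneq (row_of b.1) (row_of c.1);
have [ec2|] := eqVneq (row_of b.2) (row_of c.2); rewrite ?r2 -?ec1 -?ec2 ?hb; lia.
Qed.

Lemma plus_adjacent s1 b s2 : S = s1 ++ b :: s2 -> inR b -> ~~ e_minus b ->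
  exists b' s2', s2 = b' :: s2' /\ is_plus b b'.
Proof.
move=> e Rb mb; have sb : singular b by case/andP: Rb.
have [b' pbb] := plus_pair cher sb mb.
have [r1 r2 e1 e2] := plus_rows pbb; move: (mb); rewrite e_minusE => /negbTE hb.
have Pb' := plus_inP sb pbb.
have lt : special_lt b b'.
  by rewrite special_ltE r1 r2 hb !eqxx !ltnn /= /lt2 e1 e2 eqxx ltnSn orbT.
have [_ i2] := special_seq_split e Pb'; rewrite lt in i2.
case/splitPr: s2 / i2 e => u v e.
case: u e => [|c u] e; first by exists b', v.
have e' : S = (s1 ++ b :: c :: u) ++ b' :: v by rewrite e -catA.
have Pc : inP c by rewrite -(mem_special_seq c) e mem_cat !inE eqxx !orbT.
have [_] := special_seq_split e Pc; rewrite mem_head => /esym bc.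
have [] := special_seq_split e' Pc; rewrite mem_cat !inE eqxx !orbT => /esym cb _.
exfalso; move: bc cb; rewrite !special_ltE r1 r2 hb /lt1 /lt2 -!val_eqE /= e1 e2.
have [ec1|] := eqVneq (row_of b.1) (row_of c.1);
have [ec2|] := eqVneq (row_of b.2) (row_of c.2); rewrite ?r2 -?ec1 -?ec2 ?hb; lia.
Qed.

(** A pair xi of R of sign - could be left alone only if the scan had already consumed
    xi^- as the second pair of an item.  That item is not (xi'^-, xi'), as xi^- is not
    singular, and not (xi', xi'^+), as xi' would lie in the block of xi and have sign +.
    A pair of R of sign + is followed by its xi^+. *)
Lemma scan_proper : all proper_item (scan S).
Proof.
suff H s s0 : S = s0 ++ s ->
    (if s is b :: _ then ~~ (inR b && e_minus b) else true) -> all proper_item (scan s).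
  apply: (H _ [::]) => //; case E : S => [|b s] //; apply/negP => /andP[Rb mb].
  by have [s1' [b' [/(congr1 size)]]] := minus_adjacent (s1 := [::]) E Rb mb; rewrite size_rcons.
elim/scan_ind: s s0 => [//|b|b b' s IH1 IH2] s0 e nm /=.
  rewrite andbT; apply/negP => Rb; rewrite Rb /= in nm.
  by have [b' [s2' []]] := plus_adjacent e Rb nm.
have e2 : S = (s0 ++ [:: b; b']) ++ s by rewrite e -catA.
have next_minus c s' : s = c :: s' -> inR c -> e_minus c -> is_minus c b'.
  move=> es Rc mc; rewrite es in e2; have [s1' [b'' [+ mm]]] := minus_adjacent e2 Rc mc.
  have -> : s0 ++ [:: b; b'] = rcons (rcons s0 b) b' by rewrite -!cats1 -catA.
  by move=> /rcons_inj[_ ->].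
case: ifP => [/and3P[Rb mb mbb]|nmb] /=.
  rewrite Rb mb mbb /=; apply: (IH1 _ e2).
  case: s {IH1 IH2 e e2} next_minus => // c s' next; apply/negP => /andP[Rc mc].
  have := minus_not_singular _ (next c s' erefl Rc mc); case/andP: Rc => -> _ /(_ isT).
  by case/andP: Rb => ->.
case: ifP => [/and3P[Rb mb pbb]|npb] /=.
  rewrite Rb mb pbb /=; apply: (IH1 _ e2).
  case: s {IH1 IH2 e e2} next_minus => // c s' next; apply/negP => /andP[Rc mc].
  have [r1 r2 _ _] := minus_rows (next c s' erefl Rc mc).
  have [r3 r4 _ _] := plus_rows pbb.
  by move: mb mc; rewrite !e_minusE -r1 -r2 r3 r4 => /negbTE ->.
apply/andP; split; last first.
  apply: (IH2 (rcons s0 b)); first by rewrite cat_rcons.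
  apply/negP => /andP[Rb' mb']; have [|s1' [b'' [+ mm]]] :=
    minus_adjacent (s1 := rcons s0 b) (s2 := s) _ Rb' mb'; first by rewrite cat_rcons.
  move=> /rcons_inj[_ eb]; rewrite -eb in mm.
  by rewrite Rb' mb' mm in nmb.
apply/negP => Rb; rewrite Rb /= in nm npb.
by have [b'' [s2' [[<- _] pp]]] := plus_adjacent e Rb nm; rewrite nm pp in npb.
Qed.

Section Fusion.
Variables (K : fieldType) (q : K) (A : algType K) (t : 'I_n.-1 -> A).
Local Notation ang := (angle q).
Hypothesis braidT : forall k l : 'I_n.-1, l = k.+1 :> nat -> t k * t l * t k = t l * t k * t l.
Hypothesis commT : forall k l : 'I_n.-1, (k.+1 < l)%N || (l.+1 < k)%N -> t k * t l = t l * t k.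
Hypothesis quadT : forall k, (t k - q%:A) * (t k + 1) = 0.
Hypothesis q1 : q != 1.
Hypothesis q0 : q != 0.
Local Notation T := (alg_T t).
Variables (x : 'I_n -> K).
Hypothesis gx : generic x.
Hypothesis Fx : Fspace q x.
Local Notation y := (ext x).
Local Notation F := (pair_factor q t x).

(** Along a row the coordinates of a point of F_lambda are multiplied by q. *)
Lemma Fspace_step (i j : 'I_n) : i.+1 = j -> row_of i = row_of j -> x j = q * x i.
Proof.
move=> ij r; have := content_same_row cher (_ : (i <= j)%N) r.
rewrite -ij => /(_ (leqnSn _)) e; rewrite subSnn in e.
have := (proj2 Fx) i j r; rewrite e expfzDr // mulrC expr1z -mulrA.
by move=> /(mulfI (expfz_neq0 _ q0)) ->.
Qed.

Definition pair_phi b := F b.1 b.2.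
Definition item_prod it := \prod_(b <- item_pairs it) pair_phi b.
(** The product of the factors of xi^- and xi with its pole removed, where [c] is the
    scalar of xi^-; at c = -q it is the three-term factor. *)
Definition fused_minus (c : K) k := T k * T k.+1 + c *: (T k.+1 + 1).
Definition fused_plus (c : K) k := T k.+1 * T k + c *: (T k.+1 + 1).
Definition item_fused it :=
  match it with
  | Single b => pair_phi b
  | MinusPair b b' => fused_minus (ang (x b.2 / x b.1)) (b'.2 - b'.1 - 1)
  | PlusPair b b' => fused_plus (ang (x b'.2 / x b'.1)) (b.2 - b.1 - 1)
  end.
(** The intermediate stage, where only the pairs of sign + are fused. *)
Definition item_plus_fused it := if it is PlusPair _ _ then item_fused it else item_prod it.

Lemma pair_phiE b : pair_phi b = T (b.2 - b.1)%N + (ang (x b.2 / x b.1))%:A.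
Proof. by rewrite /pair_phi /pair_factor !ext_val. Qed.

Lemma prod_unscan its : \prod_(it <- its) item_prod it = \prod_(b <- unscan its) pair_phi b.
Proof.
elim: its => [|it its IH]; first by rewrite !big_nil.
by rewrite big_cons IH -[unscan (it :: its)]/(item_pairs it ++ unscan its) big_cat.
Qed.

Definition nat_pair b : nat * nat := (b.1 : nat, b.2 : nat).

Lemma mem_nat_pair s i j : ((i, j) \in map nat_pair s) ->
  exists (i' j' : 'I_n), [/\ i = i', j = j' & (i', j') \in s].
Proof. by case/mapP => -[i' j'] bs [-> ->]; exists i', j'. Qed.

Lemma nat_pair_mem s (i j : 'I_n) : ((i : nat, j : nat) \in map nat_pair s) = ((i, j) \in s).
Proof.
apply/idP/idP => [/mem_nat_pair[i' [j' [/val_inj <- /val_inj <-]]]//|].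
exact: (map_f nat_pair).
Qed.

Lemma subseq_special s : subseq s S ->
  {in map nat_pair s, forall c : nat * nat, c.1 < c.2 < n}%N /\ compatible (map nat_pair s).
Proof.
move=> ss; split.
  move=> _ /mapP[[i j] /(mem_subseq ss) + ->] /=.
  by rewrite mem_special_seq /inP /= => ->; rewrite ltn_ord.
rewrite /compatible pairwise_map.
apply: sub_pairwise (subseq_pairwise ss (special_seq_pairwise lam)).
by move=> b c /(special_lt_below cher).
Qed.

Lemma prod_nat_pair s : \prod_(b <- s) pair_phi b = \prod_(b <- map nat_pair s) F b.1 b.2.
Proof. by rewrite big_map. Qed.

(** The items of [L] keep their original factors, so that [left_eigen] applies to the
    initial segment of the special sequence before [b]. *)
Lemma fuse_plus_pair L b b' R : scan S = L ++ PlusPair b b' :: R ->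
  \prod_(it <- L) item_prod it * item_prod (PlusPair b b') =
  \prod_(it <- L) item_prod it * item_fused (PlusPair b b').
Proof.
move=> e; have := scan_proper; rewrite e all_cat => /andP[_ /andP[/and3P[Rb mb pbb] _]].
have eS : S = unscan L ++ b :: b' :: unscan R.
  by rewrite -[LHS]unscanK e unscan_cat.
have sb : singular b by case/andP: Rb.
have [r1 r2 e1 e2] := plus_rows pbb.
have b1 : (b.1.+1 < b.2)%N by have := plus_inP sb pbb; rewrite /inP e1 e2.
have xs : x b'.1 = q * x b.1 by apply: Fspace_step.
rewrite prod_unscan /item_prod !big_cons big_nil mulr1 !pair_phiE e1 e2.
have -> : (b.2 - b.1 = (b.2 - b.1 - 1).+1)%N by lia.
have -> : (b.2 - b.1.+1 = b.2 - b.1 - 1)%N by lia.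
rewrite /= /fused_plus e2; apply: fuse_left.
- have -> : x b.2 / x b.1 = q * (x b.2 / x b'.1).
    by rewrite xs invfM (mulrCA (x b.2)) mulVKf.
  have nb : b.2 != b'.1 by rewrite -val_eqE /= e1; lia.
  have nb' : b.2 != b.1 by rewrite -val_eqE /=; lia.
  apply: angle_qM; first exact: (generic_neq1 gx).
  have -> : q * (x b.2 / x b'.1) = x b.2 / x b.1.
    by rewrite xs invfM (mulrCA (x b.2)) mulVKf.
  exact: (generic_neq1 gx).
have ss : subseq (unscan L) S by rewrite eS; apply: prefix_subseq.
have [f1 f2] := subseq_special ss.
have mL c : inP c -> (c \in unscan L) = special_lt c b.
  by move=> Pc; have [] := special_seq_split eS Pc.
rewrite prod_nat_pair (prod_colex (@factor_comm K q n A t commT x) f1 f2).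
apply: (@left_eigen _ q n A t braidT commT quadT x gx q1
  (fun i j => (i, j) \in map nat_pair (unscan L)) b.1 b.2).
- by rewrite b1 ltn_ord.
- by rewrite -e1 !ext_val.
- by move=> i' j' /f1 /andP[].
- move=> i' j' jj /mem_nat_pair[i [j [ei ej ij]]].
  have Pij : inP (i, j) by rewrite -mem_special_seq (mem_subseq ss).
  move: mb; rewrite e_minusE => /negbTE hb; rewrite ei; rewrite ej in jj.
  move: ij; rewrite mL // special_ltE /=.
  case/orP => [|/andP[/eqP er2 /orP[/(row_of_lt cher)//|/andP[/eqP er1]]]].
    by rewrite ltnNge (row_of_mono cher jj).
  by rewrite er1 er2 hb /lt2 /= => /orP[|/andP[_ //]]; rewrite ltnNge jj.
- move=> j' /andP[ij jj]; have jn : (j' < n)%N by have := ltn_ord b.2; lia.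
  rewrite -[j']/(val (Ordinal jn)) nat_pair_mem mL // special_ltE /lt2 -!val_eqE /=.
  have := @row_of_mono _ cher (Ordinal jn) b.2 (ltnW jj); move: mb; rewrite e_minusE => /negbTE hb.
  by rewrite eqxx; case: ltngtP => //= -> _; rewrite hb jj orbT.
- move=> j' /andP[ij jj]; have jn : (j' < n)%N by have := ltn_ord b.2; lia.
  rewrite -e1 -[j']/(val (Ordinal jn)) nat_pair_mem mL; last by rewrite /inP /= e1.
  rewrite special_ltE /lt2 -!val_eqE /= r1.
  have := @row_of_mono _ cher (Ordinal jn) b.2 (ltnW jj); move: mb; rewrite e_minusE => /negbTE hb.
  by rewrite eqxx; case: ltngtP => //= -> _; rewrite hb jj orbT.
Qed.

Lemma proper_item_row it : proper_item it -> {in item_pairs it, forall c,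
   row_of c.2 = row_of (item_head it).2}.
Proof.
case: it => [b|b b'|b b'] /=; first by move=> _ c; rewrite inE => /eqP ->.
  by move=> /and3P[_ _ /minus_rows[_ r _ _]] c; rewrite !inE => /orP[] /eqP ->.
by move=> /and3P[_ _ /plus_rows[_ r _ _]] c; rewrite !inE => /orP[] /eqP ->.
Qed.

(** Here [R] has its pairs of sign + already fused.  The items of [R] in the column of
    [b'] form an initial segment [R1] of [R] without pairs of sign +, and [right_eigen]
    applies to it. *)
Lemma fuse_minus_pair L b b' R : scan S = L ++ MinusPair b b' :: R ->
  item_prod (MinusPair b b') * \prod_(it <- R) item_plus_fused it =
  item_fused (MinusPair b b') * \prod_(it <- R) item_plus_fused it.
Proof.
move=> e; have := scan_proper; rewrite e all_cat => /andP[_ /= /andP[/and3P[Rb mb mbb] pR]].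
have eS : S = (unscan L ++ [:: b]) ++ b' :: unscan R.
  by rewrite -[LHS]unscanK e unscan_cat -catA.
have sb : singular b' by case/andP: Rb.
have [r1 r2 e1 e2] := minus_rows mbb.
have b1 : (b'.1.+1 < b'.2)%N by have := minus_inP sb mbb; rewrite /inP e1; lia.
have xs : x b'.2 = q * x b.2 by apply: Fspace_step.
have e3 : b'.2.-1 = b.2 by rewrite -e2.
have mR c : inP c -> (c \in unscan R) = special_lt b' c.
  by move=> Pc; have [] := special_seq_split eS Pc.
have inR_P c : c \in unscan R -> inP c.
  by move=> cR; rewrite -mem_special_seq eS mem_cat inE cR !orbT.
pose p it := row_of (item_head it).2 == row_of b'.2.
have [R1 [R2 [eR pR1 hR2]]] := split_prefix p R.
have hb : last_content lam (row_of b'.1) == last_content lam (row_of b'.2) by rewrite -e_minusE.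
(* A row between that of [b'.1] and that of [b'.2] has the same last content as these,
   so that all blocks after [b'] in its column have sign -. *)
have half1 : \prod_(it <- R1) item_plus_fused it = \prod_(it <- R1) item_prod it.
  apply: eq_big_seq => -[//|//|c c'] cR1.
  have /and3P[Rc mc _] : proper_item (PlusPair c c').
    by move/allP: pR; apply; rewrite eR mem_cat cR1.
  have /eqP /= rc : p (PlusPair c c') by move/allP: pR1; apply.
  have cR : c \in unscan R.
    by apply/flatten_mapP; exists (PlusPair c c'); rewrite /= ?mem_head // eR mem_cat cR1.
  have Pc := inR_P _ cR; move: cR; rewrite mR // special_ltE rc eqxx ltnn /= => lt.
  case/negP: mc; rewrite e_minusE rc.
  have [c11 c12] := andP (row_of_range cher c.1); have [b11 b12] := andP (row_of_range cher b'.1).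
  have [b21 b22] := andP (row_of_range cher b'.2).
  apply/eqP/(@last_content_between _ cher (row_of b'.1)); rewrite ?b11 //=; last exact/eqP.
    by case/orP: lt => [/ltnW//|/andP[/eqP->]].
  by rewrite -rc; apply: row_of_mono => //; apply: ltnW.
(* The first item beyond [R1] belongs to a later column, hence so does everything after
   it. *)
have mR1 c : inP c -> (c \in unscan R1) = special_lt b' c && (row_of c.2 == row_of b'.2).
  move=> Pc; apply/idP/andP => [/flatten_mapP[it itR1 cit]|[lt /eqP rc]].
    have itR : it \in R by rewrite eR mem_cat itR1.
    have -> := proper_item_row (allP pR _ itR) cit; split; last exact: (allP pR1).
    by rewrite -mR //; apply/flatten_mapP; exists it.
  have : c \in unscan R by rewrite mR.
  rewrite eR unscan_cat mem_cat => /orP[//|]; case: R2 eR hR2 => // it R2 eR nit cR2.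
  set d := item_head it; have eS2 : exists s, unscan (it :: R2) = d :: s.
    by rewrite /d; case: (it) => *; eexists.
  have [s es] := eS2; rewrite es in cR2.
  have dR : d \in unscan R by rewrite eR unscan_cat es mem_cat mem_head orbT.
  have := dR; rewrite mR ?inR_P // special_ltE.
  have cd : (row_of d.2 <= row_of c.2)%N.
    move: cR2; rewrite inE => /orP[/eqP -> //|cs].
    have eS3 : S = ((unscan L ++ [:: b]) ++ b' :: unscan R1) ++ d :: s.
      by rewrite eS eR unscan_cat es -!catA.
    by apply: special_lt_row; have [_ <-] := special_seq_split eS3 Pc.
  case/orP => [|/andP[/eqP ed _]]; first by rewrite -rc ltnNge cd.
  by rewrite /p -/d -ed eqxx in nit.
rewrite eR big_cat /= half1 !mulrA; congr (_ * _).
rewrite prod_unscan /item_prod !big_cons big_nil mulr1 !pair_phiE.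
have -> : (b'.2 - b'.1 = (b'.2 - b'.1 - 1).+1)%N by lia.
have -> : (b.2 - b.1 = b'.2 - b'.1 - 1)%N by rewrite e1; lia.
rewrite /= subSS subn0 /fused_minus; apply: fuse_right.
- rewrite xs e1 -mulrA.
  have nb : b.2 != b'.1 by rewrite -val_eqE /=; lia.
  have nb' : b'.2 != b'.1 by rewrite -val_eqE /=; clear -b1; lia.
  apply: angle_qM; first exact: (generic_neq1 gx).
  by rewrite mulrA -xs; apply: (generic_neq1 gx).
have ss : subseq (unscan R1) S.
  rewrite eS eR unscan_cat; apply: subseq_trans (suffix_subseq _ _).
  by apply: subseq_trans (subseq_cons _ _); apply: prefix_subseq.
have [f1 f2] := subseq_special ss.
rewrite prod_nat_pair (prod_lex (@factor_comm K q n A t commT x) f1 f2).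
apply: (@right_eigen _ q n A t braidT commT quadT x gx q1
  (fun i j => (i, j) \in map nat_pair (unscan R1)) b'.1 b'.2).
- by rewrite b1 ltn_ord.
- by rewrite e3 !ext_val.
- by move=> i' j' /f1 /andP[].
- move=> i' j' /mem_nat_pair[i [j [ei ej ij]]]; rewrite ei.
  have Pij : inP (i, j) by rewrite -mem_special_seq (mem_subseq ss).
  move: ij; rewrite mR1 // special_ltE /= /lt1 /lt2 -!val_eqE /= hb.
  by have [ii|//] := ltnP i b'.1; have := row_of_mono cher (ltnW ii); clear -ii; lia.
- move=> j' /mem_nat_pair[i [j [ei ej ij]]]; rewrite ej.
  have Pij : inP (i, j) by rewrite -mem_special_seq (mem_subseq ss).
  move: ij; rewrite mR1 // special_ltE /= /lt1 /lt2 -!val_eqE /= hb.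
  have -> : row_of i = row_of b'.1 by congr row_of; apply: val_inj; rewrite /= ei.
  by clear -ei; lia.
- move=> i' ii; have jn : (i' < n)%N by have := ltn_ord b'.2; clear -ii; lia.
  rewrite e3 -[i']/(val (Ordinal jn)) nat_pair_mem mR1; last by rewrite /inP /=; clear -ii e3; lia.
  rewrite special_ltE /lt1 -!val_eqE /= hb r2 eqxx ltnn /= andbT.
  by have := @row_of_mono _ cher b'.1 (Ordinal jn); rewrite /=; clear -ii e3; lia.
- move=> i' ii; have jn : (i' < n)%N by have := ltn_ord b'.2; clear -ii; lia.
  rewrite -[i']/(val (Ordinal jn)) nat_pair_mem mR1; last by rewrite /inP /=; clear -ii; lia.
  rewrite special_ltE /lt1 -!val_eqE /= hb eqxx ltnn /= andbT.
  by have := @row_of_mono _ cher b'.1 (Ordinal jn); rewrite /=; clear -ii e3; lia.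
Qed.

(** First the pairs of sign + are fused from right to left, then those of sign - from left
    to right. *)
Lemma prod_item_fused : \prod_(b <- S) pair_phi b = \prod_(it <- scan S) item_fused it.
Proof.
rewrite -[S in LHS]unscanK -prod_unscan.
have stage1 R L : scan S = L ++ R ->
    \prod_(it <- L ++ R) item_prod it =
    \prod_(it <- L) item_prod it * \prod_(it <- R) item_plus_fused it.
  elim: R L => [|it R IH] L e; first by rewrite cats0 big_nil mulr1.
  have := IH (rcons L it); rewrite cat_rcons => -> //.
  rewrite -cats1 big_cat big_seq1 big_cons /= mulrA; congr (_ * _).
  by case: it e => [b|b b'|b b'] e //; rewrite (fuse_plus_pair e).
have stage2 R L : scan S = L ++ R ->
    \prod_(it <- R) item_plus_fused it = \prod_(it <- R) item_fused it.
  elim: R L => [|it R IH] L e; first by rewrite !big_nil.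
  rewrite !big_cons -(IH (rcons L it)) ?cat_rcons //.
  case: it e => [b|b b'|b b'] e //; last exact: (fuse_minus_pair e).
  by rewrite /= /item_prod big_seq1.
have := stage1 (scan S) [::] erefl; rewrite /= big_nil mul1r => ->.
exact: (stage2 (scan S) [::]).
Qed.

End Fusion.
End Scan.

(** * Regular values: closure and uniqueness *)

Section Regular.
Import mpoly.
Variables (K : fieldType) (A : algType K) (n : nat).
Variables (V D : ('I_n -> K) -> Prop) (p : 'I_n -> K).
Implicit Types (f g : ('I_n -> K) -> A) (v w : A).
Local Notation reg := (regular_value V D).

Lemma tensor_eval_cat (P P' : seq ({mpoly K[n]} * A)) x :
  tensor_eval (P ++ P') x = tensor_eval P x + tensor_eval P' x.
Proof. by rewrite /tensor_eval big_cat. Qed.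

Lemma tensor_eval_scale (Q : {mpoly K[n]}) (P : seq ({mpoly K[n]} * A)) x :
  tensor_eval [seq (Q * u.1, u.2) | u <- P] x = Q.@[x] *: tensor_eval P x.
Proof.
rewrite /tensor_eval big_map scaler_sumr; apply: eq_bigr => u _ /=.
by rewrite mevalM scalerA.
Qed.

Lemma regular_value_ext f g v : (forall x, V x -> D x -> f x = g x) ->
  reg g p v -> reg f p v.
Proof.
by move=> fg [Q [P [Qp QP e]]]; exists Q, P; split=> // x Vx Dx; rewrite fg // QP.
Qed.

Lemma regular_value_cst v : reg (fun=> v) p v.
Proof.
by exists 1, [:: (1, v)]; split=> [|x _ _|]; rewrite /tensor_eval ?big_seq1 /= ?meval1 ?oner_eq0.
Qed.

(** A scalar rational function N / Q. *)
Lemma regular_value_scalar (Q N : {mpoly K[n]}) (s : ('I_n -> K) -> K) v :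
  Q.@[p] != 0 -> (forall x, V x -> D x -> Q.@[x] * s x = N.@[x]) ->
  reg (fun x => s x *: v) p ((N.@[p] / Q.@[p]) *: v).
Proof.
move=> Qp QN; exists Q, [:: (N, v)].
split=> // [x Vx Dx|]; rewrite /tensor_eval big_seq1 /= scalerA.
  by rewrite QN.
by rewrite mulrC divfK.
Qed.

Lemma regular_valueD f g v w : reg f p v -> reg g p w -> reg (fun x => f x + g x) p (v + w).
Proof.
move=> [Q [P [Qp QP e]]] [Q' [P' [Qp' QP' e']]].
exists (Q * Q'), ([seq (Q' * u.1, u.2) | u <- P] ++ [seq (Q * u.1, u.2) | u <- P']).
split=> [|x Vx Dx|]; rewrite ?mevalM ?mulf_neq0 // tensor_eval_cat !tensor_eval_scale.
  by rewrite -QP // -QP' // scalerDr !scalerA (mulrC Q'.@[x]).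
by rewrite -e -e' scalerDr !scalerA (mulrC Q'.@[p]).
Qed.

Lemma regular_valueM f g v w : reg f p v -> reg g p w -> reg (fun x => f x * g x) p (v * w).
Proof.
move=> [Q [P [Qp QP e]]] [Q' [P' [Qp' QP' e']]].
have te x : tensor_eval [seq (u.1 * u'.1, u.2 * u'.2) | u <- P, u' <- P'] x =
    tensor_eval P x * tensor_eval P' x.
  rewrite /tensor_eval mulr_suml; elim: P {QP e} => [|u P IH] /=; first by rewrite !big_nil.
  rewrite big_cat IH big_cons big_map /=; congr (_ + _).
  rewrite mulr_sumr; apply: eq_bigr => u' _ /=.
  by rewrite mevalM -scalerAl -scalerAr scalerA.
exists (Q * Q'), [seq (u.1 * u'.1, u.2 * u'.2) | u <- P, u' <- P'].
split=> [|x Vx Dx|]; rewrite ?mevalM ?mulf_neq0 // te.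
  by rewrite -QP // -QP' // -scalerAl -scalerAr scalerA.
by rewrite -e -e' -scalerAl -scalerAr scalerA.
Qed.

Lemma regular_value_prod (I : eqType) (r : seq I) (f : I -> ('I_n -> K) -> A) (v : I -> A) :
  {in r, forall i, reg (f i) p (v i)} ->
  reg (fun x => \prod_(i <- r) f i x) p (\prod_(i <- r) v i).
Proof.
elim: r => [|i r IH] H.
  apply: (regular_value_ext (g := fun=> 1)); first by move=> x _ _; rewrite big_nil.
  by rewrite big_nil; apply: regular_value_cst.
rewrite big_cons; apply: (regular_value_ext (g := fun x => f i x * \prod_(j <- r) f j x)).
  by move=> x _ _; rewrite big_cons.
apply: regular_valueM; first by apply: H; rewrite mem_head.
by apply: IH => j jr; apply: H; rewrite inE jr orbT.
Qed.

(** The value at 0 of a polynomial of bounded degree is a fixed linear combination of its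
    values at sufficiently many points. *)
Lemma poly_interpolation (r : seq K) (N : nat) : (N <= size r)%N -> uniq r ->
  exists L : seq K, forall f : {poly K}, (size f <= N)%N ->
   f.[0] = \sum_(i < N) L`_i * f.[r`_i].
Proof.
move=> Nr ur.
pose ell (i : 'I_N) : {poly K} :=
  \prod_(j < N | j != i) ((r`_i - r`_j)^-1 *: ('X - (r`_j)%:P)).
have neq (i j : 'I_N) : j != i -> r`_i - r`_j != 0.
  by rewrite subr_eq0 nth_uniq ?(leq_trans (ltn_ord _)) // eq_sym.
have ellE (i j : 'I_N) : (ell i).[r`_j] = (i == j)%:R.
  rewrite /ell horner_prod; case: eqVneq => [<-|ij].
    by rewrite big1 // => k ki; rewrite hornerZ hornerXsubC mulVf ?neq.
  by rewrite (bigD1 j) 1?eq_sym //= hornerZ hornerXsubC subrr mulr0 mul0r.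
have sell i : (size (ell i) <= N)%N.
  apply: leq_trans (size_prod_leq _ _) _.
  have -> : (\sum_(j < N | j != i) size ((r`_i - r`_j)^-1 *: ('X - (r`_j)%:P))%R =
      #|[pred j : 'I_N | j != i]| * 2)%N.
    rewrite -sum_nat_const; apply: eq_bigr => j ji.
    by rewrite size_scale ?size_XsubC // invr_eq0 neq.
  have -> : #|[pred j : 'I_N | j != i]| = N.-1.
    by rewrite (eq_card (B := predC1 i)) // cardC1 card_ord.
  by have := ltn_ord i; lia.
exists (mkseq (fun i => if insub i is Some i' then (ell i').[0] else 0) N) => f sf.
have fE : f = \sum_(i < N) f.[r`_i] *: ell i.
  apply/eqP; rewrite -subr_eq0; apply/negP => /negP nz.
  have := max_poly_roots nz (rs := take N r).
  have -> : uniq (take N r) by rewrite take_uniq.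
  have -> : all (root (f - \sum_(i < N) f.[r`_i] *: ell i)) (take N r).
    apply/(all_nthP 0) => j; rewrite size_take_min => jN.
    have jN' : (j < N)%N by lia.
    rewrite nth_take // rootE hornerD hornerN horner_sum (bigD1 (Ordinal jN')) //= big1.
      by rewrite hornerZ (ellE _ (Ordinal jN')) eqxx mulr1 addr0 subrr.
    by move=> i ij; rewrite hornerZ (ellE _ (Ordinal jN')) (negbTE ij) mulr0.
  move=> /(_ isT isT); rewrite size_take_min (minn_idPl Nr) ltnNge.
  rewrite (leq_trans (size_polyD _ _)) // geq_max sf size_polyN.
  apply: (leq_trans (size_sum _ _ _)); apply/bigmax_leqP => i _.
  exact: leq_trans (size_scale_leq _ _) (sell i).
rewrite {1}fE horner_sum; apply: eq_bigr => i _.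
by rewrite nth_mkseq // valK hornerZ [LHS]mulrC.
Qed.

Lemma meval_curve (xi : 'I_n -> {poly K}) (Q : {mpoly K[n]}) (s : K) :
  (mmap (@polyC K) xi Q).[s] = Q.@[fun k => (xi k).[s]].
Proof.
rewrite mevalE /mmap horner_sum; apply: eq_bigr => m _.
rewrite hornerM hornerC /mmap1 horner_prod; congr (_ * _).
by apply: eq_bigr => i _; rewrite horner_exp.
Qed.

(** The coefficients of the interpolation are scalars that are the same for all
    polynomials of bounded degree, so the argument works with values in any vector
    space. *)
Lemma tensor_vanish (xi : 'I_n -> {poly K}) (P : seq ({mpoly K[n]} * A)) (good : pred K) :
  (forall N, exists r : seq K, [/\ uniq r, (N <= size r)%N & all good r]) ->
  (forall s, good s -> tensor_eval P (fun k => (xi k).[s]) = 0) ->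
  tensor_eval P (fun k => (xi k).[0]) = 0.
Proof.
move=> inf van.
pose N := \max_(u <- P) size (mmap (@polyC K) xi u.1).
have [r [ur Nr gr]] := inf N; have [L HL] := poly_interpolation Nr ur.
rewrite /tensor_eval.
transitivity (\sum_(i < N) L`_i *: tensor_eval P (fun k => (xi k).[r`_i])).
  rewrite /tensor_eval; under [RHS]eq_bigr do rewrite scaler_sumr.
  rewrite exchange_big /= big_seq [RHS]big_seq; apply: eq_bigr => u uP.
  rewrite -meval_curve HL; last exact: (leq_bigmax_seq _ uP).
  by rewrite scaler_suml; apply: eq_bigr => i _; rewrite scalerA meval_curve.
rewrite big1 // => i _; rewrite van ?scaler0 //.
by apply: (allP gr); rewrite mem_nth // (leq_trans (ltn_ord i)).
Qed.

(** The two presentations P / Q and P' / Q' give Q' P = Q P' at the good points of a curve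
    through [p], hence at [p]. *)
Lemma regular_value_unique (xi : 'I_n -> {poly K}) (good : pred K) f v w :
  (forall N, exists r : seq K, [/\ uniq r, (N <= size r)%N & all good r]) ->
  (forall s, good s -> V (fun k => (xi k).[s]) /\ D (fun k => (xi k).[s])) ->
  (forall k, (xi k).[0] = p k) ->
  reg f p v -> reg f p w -> v = w.
Proof.
move=> inf gd xp [Q [P [Qp QP e]]] [Q' [P' [Qp' QP' e']]].
have tp (S : seq ({mpoly K[n]} * A)) : tensor_eval S p = tensor_eval S (fun k => (xi k).[0]).
  by apply: eq_bigr => u _; congr (_ *: _); apply: meval_eq => k; rewrite xp.
pose PP := [seq (Q' * u.1, u.2) | u <- P] ++ [seq (- Q * u.1, u.2) | u <- P'].
have := @tensor_vanish xi PP good inf.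
have H x : tensor_eval PP x =
    Q'.@[x] *: tensor_eval P x - Q.@[x] *: tensor_eval P' x.
  by rewrite tensor_eval_cat !tensor_eval_scale mevalN scaleNr.
rewrite -tp H => /(_ _)/eqP; rewrite -e -e' !scalerA (mulrC Q'.@[p]) subr_eq0.
move=> /(_ _)/eqP/(scalerI (mulf_neq0 Qp Qp')) -> // s gs.
by have [Vs Ds] := gd s gs; rewrite H -QP // -QP' // !scalerA mulrC subrr.
Qed.

End Regular.

Arguments alg_T : simpl never.

(** * Evaluation at the content point *)

Section Value.
Import mpoly.
Variable lam : diagram.
Hypothesis cher : cherednik lam.
Local Notation n := (degree lam).
Local Notation S := (special_seq lam).
Variables (K : fieldType) (q : K) (A : algType K) (t : 'I_n.-1 -> A).
Local Notation ang := (angle q).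
Hypothesis braidT : forall k l : 'I_n.-1, l = k.+1 :> nat -> t k * t l * t k = t l * t k * t l.
Hypothesis commT : forall k l : 'I_n.-1, (k.+1 < l)%N || (l.+1 < k)%N -> t k * t l = t l * t k.
Hypothesis quadT : forall k, (t k - q%:A) * (t k + 1) = 0.
Hypothesis q_pow : injective (fun i : nat => q ^+ i).
Local Notation T := (alg_T t).
Local Notation p := (@content_point _ q lam).
Local Notation V := (@Fspace _ q lam).
Local Notation D := (fun x : 'I_n -> K => injective x).
Local Notation reg := (regular_value V D).
Implicit Types b c : 'I_n * 'I_n.

Lemma q_neq0 : q != 0.
Proof. by apply/eqP => e; have := @q_pow 1 2; rewrite /= e !expr0n /= => /(_ erefl). Qed.

Lemma q_neq1 : q != 1.
Proof. by apply/eqP => e; have := @q_pow 1 2; rewrite /= e !expr1n => /(_ erefl). Qed.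

Lemma q_exp_inj : injective (fun a : int => q ^ a).
Proof.
have H (a : int) (d : nat) : q ^ (a + d%:Z) = q ^ a -> d = 0%N.
  rewrite expfzDr ?q_neq0 // -[RHS]mulr1 => /(mulfI (expfz_neq0 _ q_neq0)) e.
  by apply: q_pow; rewrite /= expr0.
move=> a b /= e; have [ab|ab] : a = b + (absz (a - b))%:Z \/ b = a + (absz (a - b))%:Z by lia.
  by have := H b _ (etrans (congr1 (fun z => q ^ z) (esym ab)) e); lia.
by have := H a _ (etrans (congr1 (fun z => q ^ z) (esym ab)) (esym e)); lia.
Qed.

Lemma p_neq0 i : p i != 0.
Proof. exact/expfz_neq0/q_neq0. Qed.

Lemma p_eq i j : (p i == p j) = (content i == content j).
Proof. exact: (inj_eq q_exp_inj). Qed.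

(** <x_j / x_i> = (1 - q) x_i / (x_i - x_j), with nonzero denominator at the content
    point. *)
Lemma regular_angle (i j : 'I_n) : content i != content j ->
  reg (fun x => (ang (x j / x i))%:A : A) p (ang (p j / p i))%:A.
Proof.
rewrite -p_eq => pij.
have e x : x i != 0 -> x i != x j ->
    ang (x j / x i) = ((1 - q) *: 'X_i : {mpoly K[n]}).@[x] / ('X_i - 'X_j).@[x].
  move=> xi xij; rewrite mevalZ mevalB !mevalXU /angle; field.
  by rewrite xi subr_eq0 xij.
rewrite e ?p_neq0 //; apply: (regular_value_scalar (Q := 'X_i - 'X_j)).
  by rewrite mevalB !mevalXU subr_eq0.
move=> x [xn _] xinj; have xij : x i != x j.
  by apply: contra pij => /eqP/xinj ->.
rewrite e ?xn // mulrC divfK // mevalB !mevalXU subr_eq0 //.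
Qed.

Lemma regular_ratio (i j : 'I_n) (v : A) :
  reg (fun x => (1 - x j / x i) *: v) p ((1 - p j / p i) *: v).
Proof.
have e x : x i != 0 -> 1 - x j / x i = ('X_i - 'X_j : {mpoly K[n]}).@[x] / ('X_i).@[x].
  by move=> xi; rewrite mevalB !mevalXU; field.
rewrite e ?p_neq0 //; apply: (regular_value_scalar (Q := 'X_i)); rewrite ?mevalXU ?p_neq0 //.
by move=> x [xn _] _; rewrite e // mevalXU mulrC divfK.
Qed.

Definition pair_value b : A :=
  if singular b && ~~ inR b then (1 - q)%:A
  else T (b.2 - b.1)%N + (ang (p b.2 / p b.1))%:A.

Definition item_value it : A :=
  match it with
  | Single b => pair_value b
  | MinusPair _ b' => let k := (b'.2 - b'.1 - 1)%N in T k * T k.+1 - q *: T k.+1 - q%:A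
  | PlusPair b _ => let k := (b.2 - b.1 - 1)%N in T k.+1 * T k - q *: T k.+1 - q%:A
  end.

(** The contribution of the pair to delta_lambda. *)
Definition pair_delta b (x : 'I_n -> K) : K :=
  if parallel_heads b then 1 - x b.2 / x b.1 else 1.

Definition item_delta (it : item lam) x : K := \prod_(b <- item_pairs it) pair_delta b x.

Lemma delta_scan x : delta x = \prod_(it <- scan S) item_delta it x.
Proof.
transitivity (\prod_(b <- S) pair_delta b x).
  rewrite /delta big_mkcond (big_uniq _ (special_seq_uniq lam)) [RHS]big_mkcond /=.
  apply: eq_bigr => b _; rewrite mem_special_seq /pair_delta.
  case: ifP => [ph|_]; last by case: ifP.
  by have /andP[->] := parallel_heads_singular ph.
rewrite -[in LHS](unscanK S); elim: (scan S) => [|it its IH]; first by rewrite !big_nil.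
by rewrite big_cons -IH -[unscan (it :: its)]/(item_pairs it ++ unscan its) big_cat.
Qed.

Lemma pair_delta1 b x : ~~ singular b -> pair_delta b x = 1.
Proof. by rewrite /pair_delta; case: ifP => // /parallel_heads_singular ->. Qed.

Lemma pair_delta1R b x : inR b -> pair_delta b x = 1.
Proof. by rewrite /pair_delta => /andP[_ /negbTE ->]. Qed.

(** At the content point x_(c.2) / x_(c.1) = 1/q, and <1/q> = -q. *)
Lemma regular_three (c : 'I_n * 'I_n) (u v : A) :
  content c.1 = content c.2 + 1 ->
  reg (fun x => u + ang (x c.2 / x c.1) *: (v + 1)) p (u - q *: v - q%:A).
Proof.
move=> e; have -> : u - q *: v - q%:A = u + (ang (p c.2 / p c.1))%:A * (v + 1).
  have -> : p c.2 / p c.1 = q^-1.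
    rewrite /content_point e expfzDr ?q_neq0 // expr1z invfM mulrA mulfV ?mul1r //.
    exact/expfz_neq0/q_neq0.
  by rewrite angle_qV ?q_neq0 ?q_neq1 // mulr_algl scalerDr !scaleNr addrA.
apply: (regular_value_ext (g := fun x => u + (ang (x c.2 / x c.1))%:A * (v + 1))).
  by move=> x _ _; rewrite mulr_algl.
apply: regular_valueD; first exact: regular_value_cst.
apply: regular_valueM; last exact: regular_value_cst.
by apply: regular_angle; rewrite e; lia.
Qed.

(** A lone singular pair is a pair of parallel heads, whose factor loses its pole when it
    is multiplied by its factor of delta_lambda; the two pairs of a fused item contribute
    nothing to delta_lambda. *)
Lemma regular_item it : proper_item it -> {in item_pairs it, forall b, inP b} ->
  reg (fun x => item_delta it x *: item_fused q t x it) p (item_value it).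
Proof.
rewrite /item_delta; case: it => [b|b b'|b b'] /= pr Pit.
- rewrite /pair_value pr andbT.
  have [sb|nsb] := boolP (singular b).
    have phb : parallel_heads b by move: pr; rewrite /inR sb /= negbK.
    have cb : content b.1 = content b.2 by case/andP: sb => _ /eqP.
    apply: (regular_value_ext
      (g := fun x => (1 - x b.2 / x b.1) *: T (b.2 - b.1)%N + (1 - q)%:A)).
      move=> x [xn _] xinj; rewrite big_seq1 /pair_delta phb pair_phiE scalerDr scalerA.
      congr (_ + _%:A); rewrite mulrC divfK // subr_eq0 eq_sym generic_neq1 //.
      by case/andP: sb; rewrite /inP -val_eqE /= neq_ltn => ->; rewrite orbT.
    have {2}-> : (1 - q)%:A = (1 - p b.2 / p b.1) *: T (b.2 - b.1)%N + (1 - q)%:A.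
      by rewrite /content_point cb divff ?subrr ?scale0r ?add0r // expfz_neq0 ?q_neq0.
    by apply: regular_valueD; [apply: regular_ratio | apply: regular_value_cst].
  apply: (regular_value_ext (g := fun x => T (b.2 - b.1)%N + (ang (x b.2 / x b.1))%:A)).
    by move=> x _ _; rewrite big_seq1 pair_delta1 // scale1r pair_phiE.
  apply: regular_valueD; first exact: regular_value_cst.
  by apply: regular_angle; move: nsb; rewrite /singular Pit ?mem_head.
- case/and3P: pr => Rb mb mbb; have sb : singular b' by case/andP: Rb.
  have [r1 r2 e1 e2] := minus_rows mbb.
  apply: (regular_value_ext (g := fun x => T (b'.2 - b'.1 - 1)%N * T (b'.2 - b'.1 - 1).+1 +
     ang (x b.2 / x b.1) *: (T (b'.2 - b'.1 - 1).+1 + 1))).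
    move=> x _ _; rewrite !big_cons big_nil (pair_delta1R x Rb) pair_delta1 ?mulr1 ?scale1r //.
    exact: minus_not_singular mbb.
  apply: regular_three; rewrite e1; case/andP: sb => _ /eqP ->.
  have := content_same_row cher (_ : (b.2 <= b'.2)%N) r2; rewrite -e2 => /(_ (leqnSn _)) ->.
  by rewrite subSnn.
- case/and3P: pr => Rb mb pbb; have sb : singular b by case/andP: Rb.
  have [r1 r2 e1 e2] := plus_rows pbb.
  apply: (regular_value_ext (g := fun x => T (b.2 - b.1 - 1).+1 * T (b.2 - b.1 - 1)%N +
     ang (x b'.2 / x b'.1) *: (T (b.2 - b.1 - 1).+1 + 1))).
    move=> x _ _; rewrite !big_cons big_nil (pair_delta1R x Rb) pair_delta1 ?mulr1 ?scale1r //.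
    exact: plus_not_singular pbb.
  apply: regular_three; rewrite e2; case/andP: sb => _ /eqP <-.
  have := content_same_row cher (_ : (b.1 <= b'.1)%N) (esym r1); rewrite e1 => /(_ (leqnSn _)) ->.
  by rewrite subSnn.
Qed.

Lemma prod_special_seq x : \prod_(0 <= i < n) \prod_(i.+1 <= j < n) pair_factor q t x i j =
  \prod_(b <- S) pair_phi q t x b.
Proof.
have [f1 f2] := subseq_special cher (subseq_refl S).
rewrite prod_nat_pair (prod_lex (@factor_comm K q n A t commT x) f1 f2).
rewrite big_nat [RHS]big_nat; apply: eq_bigr => i /andP[_ iln].
rewrite (big_nat_widenl _ 0) //= big_nat_cond [RHS]big_nat_cond; apply: eq_bigl => j.
case: ltnP => //= jn.
have -> : (i, j) = (val (Ordinal iln), val (Ordinal jn)) by [].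
by rewrite nat_pair_mem mem_special_seq.
Qed.

Lemma fused_regular w0 ks : longest_element w0 -> reduced_decomposition w0 ks ->
  reg (fun x => delta x *: alg_phi_prod q t 1%g ks x) p (\prod_(it <- scan S) item_value it).
Proof.
move=> long red.
apply: (regular_value_ext
  (g := fun x => \prod_(it <- scan S) (item_delta it x *: item_fused q t x it))).
  move=> x Vx xinj; have gx : generic x by split=> //; case: Vx.
  rewrite (alg_phi0_longest braidT commT quadT long red gx) prod_special_seq.
  by rewrite (prod_item_fused cher braidT commT quadT q_neq1 q_neq0 gx) // delta_scan -scaler_prod.
apply: regular_value_prod => it itS; apply: regular_item.
  exact: (allP (scan_proper cher)).
move=> b bit; rewrite -mem_special_seq -(unscanK S).
by apply/flatten_mapP; exists it.
Qed.

(** The powers of q in the directions of the line separate the rows: numbers in different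
    rows have coordinates with different linear coefficients, or different values at
    0. *)
Lemma regular_unique (f : ('I_n -> K) -> A) v w : reg f p v -> reg f p w -> v = w.
Proof.
pose xi (k : 'I_n) : {poly K} := p k *: (1 + (q ^+ row_of k) *: 'X).
have xiE k s : (xi k).[s] = p k * (1 + q ^+ row_of k * s).
  by rewrite hornerZ hornerD hornerZ hornerX hornerC.
pose B := \prod_k xi k * \prod_(b : 'I_n * 'I_n | b.1 != b.2) (xi b.1 - xi b.2).
have xi0 k : xi k != 0.
  apply/eqP => e; have := p_neq0 k; have := xiE k 0.
  by rewrite e horner0 mulr0 addr0 mulr1 => <-; rewrite eqxx.
have xi1 k : (xi k)`_1 = p k * q ^+ row_of k.
  by rewrite coefZ coefD coefZ coefX coef1 add0r mulr1.
have xi0' k : (xi k)`_0 = p k.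
  by rewrite coefZ coefD coefZ coefX coef1 mulr0 addr0 mulr1.
have xi_neq i j : i != j -> xi i - xi j != 0.
  apply: contra; rewrite subr_eq0 => /eqP e.
  have pij : p i = p j by rewrite -!xi0' e.
  have rij : row_of i = row_of j.
    apply: q_pow => /=; apply: (mulfI (p_neq0 i)).
    by rewrite -xi1 e xi1 pij.
  have cij : content i = content j by apply/eqP; rewrite -p_eq pij.
  apply/eqP/val_inj => /=; case: (leqP i j) => [ij|/ltnW ij].
    by have := content_same_row cher ij rij; lia.
  by have := content_same_row cher ij (esym rij); lia.
have B0 : B != 0.
  rewrite mulf_neq0 //; first by apply/prodf_neq0 => k _.
  by apply/prodf_neq0 => b; apply: xi_neq.
apply: (@regular_value_unique _ _ _ _ _ _ xi (fun s => B.[s] != 0)).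
(* [B] has fewer than [size B] roots, so [M] distinct powers of q contain N good ones. *)
- move=> N; pose M := (N + size B)%N; pose r0 := [seq q ^+ i | i <- iota 0 M].
  have ur0 : uniq r0 by rewrite map_inj_uniq ?iota_uniq.
  exists [seq s <- r0 | B.[s] != 0]; split; [exact: filter_uniq | | exact: filter_all].
  have := count_predC (root B) r0; rewrite size_map size_iota /M => e.
  have : (count (root B) r0 < size B)%N.
    rewrite -size_filter; apply: max_poly_roots => //; last exact: filter_uniq.
    exact: filter_all.
  have -> : size [seq s <- r0 | B.[s] != 0] = count (predC (root B)) r0 by rewrite size_filter.
  by lia.
- move=> s; rewrite /B hornerM mulf_eq0 negb_or !horner_prod.
  move=> /andP[/prodf_neq0 h1 /prodf_neq0 h2].
  split; last first.
    move=> i j /eqP; apply: contraTeq => ij; have := h2 (i, j) ij.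
    by rewrite hornerD hornerN subr_eq0.
  split=> [k|k l rkl]; first exact: h1.
  by rewrite !xiE rkl /content_point; ring.
- by move=> k; rewrite xiE mulr0 addr0 mulr1.
Qed.

End Value.

(** * The Hecke algebra over C(q) *)

Section Bridge.
Variables (R : realType).

Lemma qvar_pow_inj : injective (fun i : nat => qvar R ^+ i).
Proof.
move=> i j /=; rewrite /qvar -!rmorphXn => /eqP; rewrite tofrac_eq => /eqP e.
by have := congr1 (fun f : {poly _} => size f) e; rewrite !size_polyXn => -[].
Qed.

Lemma fused_factors_scan (lam : diagram) s :
  fused_factors (qvar R) s =
  map (item_value (qvar R) (@hecke_gen _ (qvar R) (degree lam))) (scan (lam := lam) s).
Proof.
elim/scan_ind: s => [//|//|b b' s IH1 IH2]; cbn [fused_factors scan].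
case: ifP => _; first by rewrite IH1.
case: ifP => _; first by rewrite IH1.
exact: (congr1 (cons (factor (qvar R) b)) IH2).
Qed.

End Bridge.

Theorem corollary9 (R : realType) (lam : diagram) (w0 : {perm 'I_(degree lam)})
    (ks : seq 'I_(degree lam).-1) :
  cherednik lam ->
  longest_element w0 ->
  reduced_decomposition w0 ks ->
  E_element (qvar R) ks = fused_product (qvar R) lam.
Proof.
move=> cher long red.
have isE : is_E (q := qvar R) ks (fused_product (qvar R) lam).
  have := fused_regular cher (@hecke_braid _ (qvar R) (degree lam))
    (@hecke_comm _ (qvar R) (degree lam)) (@hecke_quad _ (qvar R) (degree lam))
    (@qvar_pow_inj R) long red.
  by rewrite /fused_product fused_factors_scan big_map.
apply: classical_sets.xget_unique => // v Ev.
exact: (@regular_unique lam cher (Cq R) (qvar R) _ (@qvar_pow_inj R) _ _ _ Ev isE).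
Qed.
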